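(* Let $f:\mathbb{D}\to\mathbb{D}$ be holomorphic. The linear map defined on the kernel functions of $H^2$ by $$V_fk_w=k_{f(w)}\otimes c_{f,w},\qquad w\in\mathbb{D},$$ extends to an isometry $V_f:H^2\to H^2\otimes\mathcal{H}(f)$. The formula $$\Phi_f(S)=V_f^{*}\big(S\otimes I_{\mathcal{H}(f)}\big)V_f,\qquad S\in B(H^2),$$ defines a normal unital completely positive map on $B(H^2)$, and this Stinespring representation is minimal, i.e. the closed linear span of $\{(S\otimes I_{\mathcal{H}(f)})V_fh: S\in B(H^2),\ h\in H^2\}$ is $H^2\otimes\mathcal{H}(f)$. Moreover, for every $h\in H^\infty$, $$\Phi_f(M_h)=M_{h\circ f}.$$ If $\Phi_{f,*}$ denotes the preadjoint of $\Phi_f$ and $$\rho_w=|\widetilde k_w\rangle\langle\widetilde k_w|,\qquad \widetilde k_w=\frac{k_w}{\|k_w\|},$$ then for every $w\in\mathbb{D}$ $$\Phi_{f,*}(\rho_w)=\rho_{f(w)}.$$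
   Context: All inner products are linear in the second variable. $\mathbb{D}$ is the open unit disk, $H^2$ its Hardy space, with Szegő kernel $k(z,w)=\frac{1}{1-z\overline w}$; $k_w=k(\cdot,w)$, so $h(w)=\langle k_w,h\rangle$ for $h\in H^2$. $H^\infty$ is the algebra of bounded holomorphic functions on $\mathbb{D}$ and $M_h$ is multiplication by $h$ on $H^2$. $B(H^2)$ is the algebra of bounded operators on $H^2$. For holomorphic $f:\mathbb{D}\to\mathbb{D}$, the kernel $c_f(z,w)=\frac{1-f(z)\overline{f(w)}}{1-z\overline w}$ is positive definite on $\mathbb{D}$; its reproducing kernel Hilbert space is the de Branges-Rovnyak space $\mathcal{H}(f)$, and $c_{f,w}=c_f(\cdot,w)$, so $u(w)=\langle c_{f,w},u\rangle_{\mathcal{H}(f)}$ for $u\in\mathcal{H}(f)$. The preadjoint of a normal map $\Phi$ on $B(H^2)$ is the map $\Phi_*$ on trace-class operators with $\mathrm{Tr}(\Phi_*(\rho)S)=\mathrm{Tr}(\rho\,\Phi(S))$. For $x,y\in H^2$, $|x\rangle\langle y|$ is the operator $h\mapsto x\langle y,h\rangle$. *)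

(* Defs.v *)
From HB Require Import structures.
From mathcomp Require Import all_boot all_order all_algebra.
From mathcomp Require Import sesquilinear complex.
From mathcomp Require Import boolp classical_sets functions reals.
From mathcomp Require Import topology normedtype sequences derive.

Set Implicit Arguments.
Unset Strict Implicit.
Unset Printing Implicit Defensive.

Import Order.TTheory GRing.Theory Num.Theory.
Import numFieldNormedType.Exports.

Local Open Scope classical_set_scope.
Local Open Scope complex_scope.
Local Open Scope ring_scope.

(* The library's forms are linear in their first argument; [inner] below swaps
   the arguments so as to be linear in the second one. *)
HB.mixin Record isHilbert (R : realType) E & CompleteNormedModule R[i] E := {
  hdot : {dot E for (@Num.conj R[i])} ;
  hdot_norm : forall x : E, hdot x x = `|x| ^+ 2
}.

#[short(type="hilbertType")]
HB.structure Definition Hilbert (R : realType) :=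
  { E of isHilbert R E & CompleteNormedModule R[i] E }.

Definition inner (R : realType) (E : hilbertType R) (x y : E) : R[i] :=
  hdot y x.

Section Inner.
Context (R : realType) (E : hilbertType R).
Implicit Types x y : E.

Lemma inner_linear x : linear (inner x : E -> R[i]^o).
Proof. by move=> a y z; rewrite /inner linearPl. Qed.

Lemma innerxx x : inner x x = `|x| ^+ 2.
Proof. exact: hdot_norm. Qed.

Lemma cauchy_schwarz x y : `|inner x y| <= `|x| * `|y|.
Proof.
have [->|y0] := eqVneq y 0; first by rewrite /inner linear0l normr0 mulr_ge0.
have y2 : 0 < `|y| ^+ 2 by rewrite exprn_gt0// normr_gt0.
pose v := `|y| ^+ 2 *: x - inner y x *: y.
have conjE s t : (inner s t)^* = inner t s.
  by rewrite /inner [RHS]hermC expr0 mul1r.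
have : 0 <= inner v v by rewrite innerxx exprn_ge0.
have inB s t t' : inner s (t - t') = inner s t - inner s t'.
  by rewrite /inner linearBl.
have inZ s (a : R[i]) t : inner s (a *: t) = a * inner s t.
  by rewrite /inner linearZl_LR.
have vy : inner v y = 0.
  rewrite -conjE inB !inZ innerxx mulrC subrr; exact: conjC0.
rewrite {2}/v inB !inZ vy mulr0 subr0 pmulr_rge0// -conjE inB !inZ innerxx.
rewrite rmorphB !rmorphM/= conjE !(CrealP (normr_real _)) -normCK subr_ge0 => h.
by rewrite -(@ler_pXn2r _ 2)// ?nnegrE ?mulr_ge0// exprMn mulrC.
Qed.

End Inner.

Section Span.
Context (R : realType) (E : hilbertType R).

Definition lin_span (A : set E) : set E :=
  [set x | exists (n : nat) (c : 'I_n -> R[i]) (v : 'I_n -> E),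
     (forall i, A (v i)) /\ x = \sum_(i < n) c i *: v i].

Definition total_set (A : set E) : Prop := closure (lin_span A) = setT.

(* Bases are indexed by [nat]: they are only used on the infinite-dimensional
   separable space H^2. *)
Definition orthonormal_basis (e : nat -> E) : Prop :=
  (forall i j, inner (e i) (e j) = (i == j)%:R) /\ total_set (range e).

End Span.

Section BoundedOperators.
Context (R : realType) (E F : hilbertType R).

Definition bounded_op : {pred E -> F} :=
  [pred f : E -> F | `[< linear f /\ continuous f >]].

Lemma bounded_op_submod : submod_closed bounded_op.
Proof.
split.
  by apply/asboolP; split; [move=> a x y; rewrite scaler0 addr0|exact: cst_continuous].
move=> a f g /asboolP[lf cf] /asboolP[lg cg]; apply/asboolP; split=> [b x y|x].
  rewrite !fctE lf lg !scalerDr !scalerA [a * b]mulrC -!addrA; congr (_ + _).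
  by rewrite addrCA.
by apply: cvgD; [apply: cvgZ; [exact: cvg_cst|exact: cf]|exact: cg].
Qed.
HB.instance Definition _ :=
  GRing.isSubmodClosed.Build R[i] (E -> F) bounded_op bounded_op_submod.

Record bop := Bop { bop_val :> E -> F ; bopP : bop_val \in bounded_op }.

HB.instance Definition _ := [isSub for bop_val].
HB.instance Definition _ := [Choice of bop by <:].
HB.instance Definition _ := [SubChoice_isSubLmodule of bop by <:].

Lemma bop_linear (A : bop) : linear A.
Proof. by have /asboolP[] := bopP A. Qed.
HB.instance Definition _ (A : bop) :=
  GRing.isLinear.Build R[i] E F *:%R (bop_val A) (bop_linear A).

Lemma bop_continuous (A : bop) : continuous A.
Proof. by have /asboolP[] := bopP A. Qed.

End BoundedOperators.

Notation "''B' ( E , F )" := (bop E F) (at level 8, format "''B' ( E ,  F )").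
Notation "''B' ( E )" := (bop E E) (at level 8, format "''B' ( E )").

Section Operators.
Context (R : realType).
Implicit Types E F G : hilbertType R.

Lemma id_bop_subproof E : (@idfun E) \in @bounded_op R E E.
Proof. by apply/asboolP; split=> // x; exact: cvg_id. Qed.
Definition id_bop E : 'B(E) := Bop (id_bop_subproof E).

Lemma comp_bop_subproof E F G (A : 'B(F, G)) (B : 'B(E, F)) :
  A \o B \in @bounded_op R E G.
Proof.
apply/asboolP; split=> [a x y|x]; first by rewrite /= !linearP.
by apply: continuous_comp; exact: bop_continuous.
Qed.
Definition comp_bop E F G (A : 'B(F, G)) (B : 'B(E, F)) : 'B(E, G) :=
  Bop (comp_bop_subproof A B).

Lemma ketbra_subproof E (x y : E) :
  (fun h => inner y h *: x) \in @bounded_op R E E.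
Proof.
have lin : linear (fun h => inner y h *: x).
  by move=> a u v; rewrite inner_linear scalerDl -scalerA.
apply/asboolP; split => //.
pose L := GRing.isLinear.Build R[i] E E *:%R (fun h => inner y h *: x) lin.
pose f : {linear E -> E} := HB.pack (fun h => inner y h *: x) L.
apply: (@bounded_linear_continuous _ _ _ f).
apply/linear_boundedP; near=> r => h /=.
rewrite normrZ (le_trans (ler_wpM2r (normr_ge0 x) (cauchy_schwarz y h)))//.
rewrite mulrAC ler_wpM2r//; near: r; apply: nbhs_pinfty_ge.
by rewrite rpredM// normr_real.
Unshelve. all: by end_near. Qed.

Definition ketbra E (x y : E) : 'B(E) := Bop (ketbra_subproof x y).

(* Definite description: there is exactly one such operator. *)
Definition adjoint E F (A : 'B(E, F)) : 'B(F, E) :=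
  xget 0 [set B : 'B(F, E) | forall x y, inner (A x) y = inner x (B y)].

End Operators.

Notation "A \ob B" := (comp_bop A B)
  (at level 40, left associativity, format "A  \ob  B") : ring_scope.

(* Determined by [E] and [F] up to a unique unitary. *)
Record hilbertTensor (R : realType) (E F : hilbertType R) := HilbertTensor {
  tensor_space :> hilbertType R ;
  tensor : {bilinear E -> F -> tensor_space} ;
  inner_tensor : forall x x' y y',
    inner (tensor x y) (tensor x' y') = inner x x' * inner y y' ;
  tensor_total : total_set [set t | exists x y, t = tensor x y]
}.

(* [S (x) I]; definite description, as for [adjoint]. *)
Definition ampliation (R : realType) (E F : hilbertType R)
    (T : hilbertTensor E F) (S : 'B(E)) : 'B(T) :=
  xget 0 [set A : 'B(T) | forall x y, A (tensor T x y) = tensor T (S x) y].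

Section Trace.
Context (R : realType) (E : hilbertType R).
Implicit Types (A B S rho : 'B(E)) (Phi : 'B(E) -> 'B(E)).

Definition hilbert_schmidt A : Prop :=
  exists e : nat -> E, orthonormal_basis e /\
    cvgn (series (fun n => `|A (e n)| ^+ 2 : R[i]^o)).

(* Schatten's definition: products of two Hilbert-Schmidt operators. *)
Definition trace_class rho : Prop :=
  exists A B, [/\ hilbert_schmidt A, hilbert_schmidt B & rho = A \ob B].

Definition has_trace rho (t : R[i]) : Prop :=
  forall e : nat -> E, orthonormal_basis e ->
    series (fun n => inner (e n) (rho (e n)) : R[i]^o) @ \oo --> (t : R[i]^o).

(* Meaningful when [rho] is trace class: then there is exactly one such [t]. *)
Definition trace rho : R[i] := xget 0 [set t | has_trace rho t].

(* Continuity for the ultraweak topology, i.e. the initial topology of the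
   functionals [S |-> Tr (rho S)] with [rho] trace class, tested on filters. *)
Definition normal Phi : Prop :=
  forall (F : set_system 'B(E)) (S0 : 'B(E)), ProperFilter F ->
    (forall rho, trace_class rho ->
       (trace (rho \ob S) : R[i]^o) @[S --> F] --> (trace (rho \ob S0) : R[i]^o)) ->
    forall rho, trace_class rho ->
      (trace (rho \ob Phi S) : R[i]^o) @[S --> F]
        --> (trace (rho \ob Phi S0) : R[i]^o).

(* The values of [Psi] outside the trace class are irrelevant. *)
Definition is_preadjoint Phi (Psi : 'B(E) -> 'B(E)) : Prop :=
  forall rho, trace_class rho ->
    trace_class (Psi rho) /\
    forall S, trace (Psi rho \ob S) = trace (rho \ob Phi S).

(* Positivity, as an operator on [E^n], of the block matrix [(S i j)]; note
   that [0 <= z] in [R[i]] means that [z] is real and nonnegative. *)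
Definition block_positive n (S : 'I_n -> 'I_n -> 'B(E)) : Prop :=
  forall x : 'I_n -> E, 0 <= \sum_i \sum_j inner (x i) (S i j (x j)).

Definition completely_positive Phi : Prop :=
  forall n (S : 'I_n -> 'I_n -> 'B(E)),
    block_positive S -> block_positive (fun i j => Phi (S i j)).

End Trace.

Section Disk.
Context (R : realType).

Record disk := Disk { disk_val :> R[i] ; diskP : `|disk_val| < 1 }.
HB.instance Definition _ := [isSub for disk_val].

(* Extension by zero; the disk being open, differentiability at its points
   does not depend on the extension. *)
Definition disk_ext (g : disk -> R[i]) : R[i]^o -> R[i]^o :=
  fun z => if insub z is Some w then g w else 0.

Definition holomorphic (g : disk -> R[i]) : Prop :=
  forall w : disk, derivable (disk_ext g) (w : R[i]^o) 1.

Definition Hinfty (h : disk -> R[i]) : Prop :=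
  holomorphic h /\ exists M : R[i], forall z, `|h z| <= M.

(* [fs_ev u z] is the value of [u] at [z]. *)
Record functionSpace := FunctionSpace {
  fs_space :> hilbertType R ;
  fs_ev : {linear fs_space -> (disk -> R[i]^o)} ;
  fs_ev_inj : injective fs_ev
}.

Definition is_multiplication (H : functionSpace) (h : disk -> R[i])
    (M : 'B(H)) : Prop :=
  forall u z, fs_ev H (M u) z = h z * fs_ev H u z.

Record rkhs (K : disk -> disk -> R[i]) := RKHS {
  rkhs_space :> functionSpace ;
  rkhs_kernel : disk -> rkhs_space ;
  rkhs_kernelE : forall z w, fs_ev rkhs_space (rkhs_kernel w) z = K z w ;
  rkhs_reproducing : forall u w,
    fs_ev rkhs_space u w = inner (rkhs_kernel w) u
}.

Definition taylor (g : disk -> R[i]) (a : nat -> R[i]) : Prop :=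
  forall z : disk,
    series (fun n => a n * (z : R[i]) ^+ n : R[i]^o) @ \oo --> (g z : R[i]^o).

(* H^2: the power series with square-summable coefficients, with the inner
   product of the coefficient sequences. *)
Record hardySpace := HardySpace {
  hardy_space :> functionSpace ;
  hardy_mem : forall g : disk -> R[i],
    (exists u, fs_ev hardy_space u = g) <->
    (exists a, taylor g a /\ cvgn (series (fun n => `|a n| ^+ 2 : R[i]^o))) ;
  hardy_inner : forall u v a b,
    taylor (fs_ev hardy_space u) a -> taylor (fs_ev hardy_space v) b ->
    series (fun n => (a n)^* * b n : R[i]^o) @ \oo --> (inner u v : R[i]^o)
}.

Definition szego (z w : disk) : R[i] := (1 - (z : R[i]) * (w : R[i])^*)^-1.

Definition hardy_kernel (H2 : hardySpace) (w : disk) : H2 :=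
  xget 0 [set u | forall z, fs_ev H2 u z = szego z w].

Definition rho_kernel (H2 : hardySpace) (w : disk) : 'B(H2) :=
  let kw := `|hardy_kernel H2 w|^-1 *: hardy_kernel H2 w in ketbra kw kw.

Definition dbr_kernel (f : disk -> disk) (z w : disk) : R[i] :=
  (1 - (f z : R[i]) * (f w : R[i])^*) / (1 - (z : R[i]) * (w : R[i])^*).

End Disk.

Definition stinespring_map (R : realType) (E F : hilbertType R)
    (T : hilbertTensor E F) (V : 'B(E, T)) (S : 'B(E)) : 'B(E) :=
  adjoint V \ob ampliation T S \ob V.

(* Main.v *)
Require Import Defs.
From HB Require Import structures.
From mathcomp Require Import all_boot all_order all_algebra.
From mathcomp Require Import sesquilinear complex.
From mathcomp Require Import boolp classical_sets functions reals.
From mathcomp Require Import topology normedtype sequences derive.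
From mathcomp Require Import cardinality ereal esum ring lra.

Set Implicit Arguments.
Unset Strict Implicit.
Unset Printing Implicit Defensive.

Import Order.TTheory GRing.Theory Num.Theory.
Import numFieldNormedType.Exports.

Local Open Scope classical_set_scope.
Local Open Scope complex_scope.
Local Open Scope ring_scope.

(** The vectors [k_(f w) (x) c_w] have the same Gram matrix as the kernels [k_w],
    because [k(f z, f w) c_f(z, w) = k(z, w)]; as the [k_w] are total in [H^2], this
    gives the isometry [V].

    Statements about [S (x) I] are reduced to operators on [H^2] by slicing.
    [H(f)] has a countable complete orthogonal system [g_a] of vectors of norm [0]
    or [1]: [k - c_f] is positive definite, so [k_w |-> c_w] extends to a
    contraction [H^2 -> H(f)] with dense range, and Gram-Schmidt applies to the
    image of a basis. With [R_a x = x (x) g_a] one has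
    [<s, t> = sum_a <R_a^* s, R_a^* t>] and [R_a^* (S (x) I) = S R_a^*]. Hence
    [<x, Phi(S) y>] is the sum over [a] of [<R_a^* V x, S R_a^* V y>], which gives
    complete positivity. For
    [rho = A B] with [A], [B] Hilbert-Schmidt, [Tr (rho Phi(S))] is the sum over
    [n] and [a] of [<R_a^* V B^* e_n, S R_a^* V A e_n>], i.e. [Tr (rho' S)] with
    [rho'] trace class; so the preadjoint exists and [Phi] is normal.

    A series [sum_n <u_n, v_n>] is determined, by polarization, by the sums
    [sum_n |v_n + c u_n|^2] with [|c| = 1]. Independence of bases and
    interchanges of summation are thereby reduced to series of nonnegative terms. *)

(** * Squared norms as real numbers *)

Section SquaredNorm.
Context (R : realType).

(** Norms take values in [R[i]]. Passing to the ordered field [R] makes estimates accessible to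
    [lra] and [nra] and lets series be summed in [\bar R]. *)
Definition nsq (V : normedZmodType R[i]) (x : V) : R := complex.Re (`|x| ^+ 2).

Section Zmod.
Context (V : normedZmodType R[i]).
Implicit Types x y : V.

Lemma nsqE x : (nsq x)%:C = `|x| ^+ 2.
Proof. by rewrite RRe_real// rpredX// normr_real. Qed.

Lemma nsq_ge0 x : 0 <= nsq x.
Proof. by rewrite -ler0c nsqE exprn_ge0. Qed.

Lemma nsq_eq0 x : (nsq x == 0) = (x == 0).
Proof.
apply/eqP/eqP => [x0|->]; last by rewrite /nsq normr0 expr0n.
by apply/eqP; rewrite -normr_eq0 -sqrf_eq0 -nsqE x0.
Qed.

Lemma nsq0 : nsq (0 : V) = 0.
Proof. by apply/eqP; rewrite nsq_eq0. Qed.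

Lemma nsqN x : nsq (- x) = nsq x.
Proof. by rewrite /nsq normrN. Qed.

Lemma nsqB x y : nsq (x - y) = nsq (y - x).
Proof. by rewrite -nsqN opprB. Qed.

Lemma nsqD_le x y : nsq (x + y) <= 2 * nsq x + 2 * nsq y.
Proof.
rewrite -lecR rmorphD !rmorphM /= !nsqE.
have h : `|x + y| ^+ 2 <= (`|x| + `|y|) ^+ 2.
  by rewrite lerXn2r ?nnegrE ?addr_ge0// ler_normD.
apply: (le_trans h); rewrite -subr_ge0.
rewrite [_%:C](_ : _ = 2); last by rewrite rmorph_nat.
rewrite [leRHS](_ : _ = (`|x| - `|y|) ^+ 2); last by ring.
by rewrite -realEsqr rpredB// normr_real.
Qed.

Lemma nsq_norm_lt x (e : R) : 0 < e -> (`|x| < e%:C) = (nsq x < e ^+ 2).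
Proof.
move=> e0; rewrite -ltcR nsqE rmorphXn/= ltr_pXn2r// nnegrE//.
by rewrite ler0c ltW.
Qed.

End Zmod.

Lemma nsqM (c d : R[i]) : nsq (c * d) = nsq c * nsq d.
Proof.
by apply: (@complexI R); rewrite rmorphM/= !nsqE normrM exprMn.
Qed.

Lemma nsq_conj (c : R[i]) : nsq (c^*) = nsq c.
Proof. by rewrite /nsq norm_conjC. Qed.

Lemma nsqZ (V : normedModType R[i]) (c : R[i]) (x : V) :
  nsq (c *: x) = nsq c * nsq x.
Proof.
by apply: (@complexI R); rewrite rmorphM/= !nsqE normrZ exprMn.
Qed.

Section Mod.
Context (V : normedModType R[i]).

(** Positive elements of [R[i]] are real, so radii can be taken in [R], and squaring is monotone on
    them. *)
Lemma cvg_nsqP (T : Type) (F : set_system T) {FF : Filter F} (u : T -> V) (l : V) :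
  u @ F --> l <-> (forall e : R, 0 < e -> \forall n \near F, nsq (u n - l) < e).
Proof.
split=> [/cvgrPdist_lt ul e e0|ul].
  have se : 0 < Num.sqrt e by rewrite sqrtr_gt0.
  have := ul (Num.sqrt e)%:C; rewrite ltcR => /(_ se).
  apply: filterS => n; rewrite nsq_norm_lt// sqr_sqrtr 1?ltW//.
  by rewrite nsqB.
apply/cvgrPdist_lt => e e0.
have eE : (complex.Re e)%:C = e by rewrite RRe_real// gtr0_real.
have Re0 : 0 < complex.Re e by rewrite -ltcR eE.
have := ul _ (exprn_gt0 2 Re0); apply: filterS => n.
by rewrite -{2}eE nsq_norm_lt// nsqB.
Qed.

Lemma normE_nsq (x : V) : `|x| = (Num.sqrt (nsq x))%:C.
Proof.
apply/eqP; rewrite -(@eqrXn2 _ 2)// ?ler0c ?sqrtr_ge0//.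
by rewrite -rmorphXn/= sqr_sqrtr ?nsq_ge0// nsqE.
Qed.

Lemma sqrt_nsqD (x y : V) :
  Num.sqrt (nsq (x + y)) <= Num.sqrt (nsq x) + Num.sqrt (nsq y).
Proof. by rewrite -lecR rmorphD/= -!normE_nsq ler_normD. Qed.

Lemma closure_nsqP (A : set V) (x : V) :
  closure A x <-> (forall e : R, 0 < e -> exists2 a, A a & nsq (x - a) < e).
Proof.
split=> [Ax e e0|h B].
  have : nbhs x [set a | nsq (a - x) < e].
    have /cvg_nsqP : (id @ x --> x) by exact: cvg_id.
    by apply.
  by move=> /Ax[a [Aa /= ax]]; exists a => //; rewrite nsqB.
move=> /nbhs_ballP[e /= e0 eB].
have eE : (complex.Re e)%:C = e by rewrite RRe_real// gtr0_real.
have Re0 : 0 < complex.Re e by rewrite -ltcR eE.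
have [a Aa xa] := h _ (exprn_gt0 2 Re0); exists a; split => //.
by apply: eB; rewrite -ball_normE /= -eE nsq_norm_lt.
Qed.

Lemma closed_nsq_le (c : R) : closed [set x : V | nsq x <= c].
Proof.
move=> x /closure_nsqP xc /=; have [z c0 _] := xc 1 ltr01.
have {z c0} c0 : 0 <= c by apply: le_trans c0; exact: nsq_ge0.
rewrite -(@ler_sqrt _ _ c)//; apply/ler_addgt0Pr => e e0.
have [y yc xy] := xc _ (exprn_gt0 2 e0).
rewrite -[x](subrK y) addrC (le_trans (sqrt_nsqD _ _))// lerD ?ler_sqrt//.
by rewrite -[leRHS]ger0_norm ?(ltW e0)// -sqrtr_sqr ler_wsqrtr ?(ltW xy).
Qed.

End Mod.

Lemma nsq_cauchy (V : completeNormedModType R[i]) (u : nat -> V) :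
  (forall e : R, 0 < e -> exists N, forall n m, (N <= n)%N -> (N <= m)%N ->
     nsq (u n - u m) < e) -> cvgn u.
Proof.
move=> h; apply/cauchy_cvgP/cauchyP => e e0.
have eE : (complex.Re e)%:C = e by rewrite RRe_real// gtr0_real.
have Re0 : 0 < complex.Re e by rewrite -ltcR eE.
have [N hN] := h _ (exprn_gt0 2 Re0); exists (u N).
exists N => // n /= Nn; rewrite -ball_normE /= -eE nsq_norm_lt//.
exact: hN.
Qed.

End SquaredNorm.

(** * Inner product identities and polarization *)

Section InnerAlgebra.
Context (R : realType) (E : hilbertType R).
Implicit Types x y z : E.

Lemma inner_conj x y : (inner x y)^* = inner y x.
Proof. by rewrite /inner [RHS]hermC expr0 mul1r. Qed.

Lemma innerDr x y z : inner x (y + z) = inner x y + inner x z.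
Proof. by rewrite /inner linearDl. Qed.
Lemma innerZr x (a : R[i]) y : inner x (a *: y) = a * inner x y.
Proof. by rewrite /inner linearZl_LR. Qed.
Lemma inner0r x : inner x 0 = 0.
Proof. by rewrite /inner linear0l. Qed.
Lemma innerNr x y : inner x (- y) = - inner x y.
Proof. by rewrite /inner linearNl. Qed.
Lemma innerBr x y z : inner x (y - z) = inner x y - inner x z.
Proof. by rewrite innerDr innerNr. Qed.
Lemma inner_sumr (I : Type) (r : seq I) (P : pred I) x (F : I -> E) :
  inner x (\sum_(i <- r | P i) F i) = \sum_(i <- r | P i) inner x (F i).
Proof. exact: (big_morph _ (innerDr x) (inner0r x)). Qed.

Lemma innerDl x y z : inner (x + y) z = inner x z + inner y z.
Proof. by rewrite -inner_conj innerDr rmorphD/= !inner_conj. Qed.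
Lemma innerZl (a : R[i]) x y : inner (a *: x) y = a^* * inner x y.
Proof. by rewrite -inner_conj innerZr rmorphM/= inner_conj. Qed.
Lemma inner0l x : inner 0 x = 0.
Proof. by rewrite -inner_conj inner0r rmorph0. Qed.
Lemma innerNl x y : inner (- x) y = - inner x y.
Proof. by rewrite -inner_conj innerNr rmorphN/= inner_conj. Qed.
Lemma inner_suml (I : Type) (r : seq I) (P : pred I) (F : I -> E) x :
  inner (\sum_(i <- r | P i) F i) x = \sum_(i <- r | P i) inner (F i) x.
Proof.
exact: (big_morph (fun y => inner y x) (fun y z => innerDl y z x) (inner0l x)).
Qed.

Lemma inner_nsq x : inner x x = (nsq x)%:C.
Proof. by rewrite innerxx nsqE. Qed.

Lemma nsq_inner_le x y : nsq (inner x y) <= nsq x * nsq y.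
Proof.
rewrite -lecR rmorphM/= !nsqE -exprMn.
by rewrite lerXn2r ?nnegrE ?mulr_ge0// cauchy_schwarz.
Qed.

Lemma inner_ext x y : (forall z, inner z x = inner z y) -> x = y.
Proof.
move=> h; apply/eqP; rewrite -subr_eq0 -nsq_eq0; apply/eqP/(@complexI R).
by rewrite -inner_nsq innerBr h subrr.
Qed.

Lemma nsqD x y :
  (nsq (x + y))%:C = (nsq x)%:C + (nsq y)%:C + (inner x y + inner y x).
Proof. rewrite -!inner_nsq !(innerDl, innerDr); ring. Qed.

Lemma parallelogram x y : nsq (x + y) + nsq (x - y) = 2 * nsq x + 2 * nsq y.
Proof.
apply: (@complexI R); rewrite -mulrDr rmorphM rmorph_nat !rmorphD/= !nsqD nsqN.
rewrite innerNr innerNl; ring.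
Qed.

(** The cross terms of [nsq (y + c *: x)] are [c * inner y x] and [c^* * inner x y]. Weighting the
    values at [1, -1, 'i, -'i] by these same scalars cancels the first kind and adds up the
    second. *)
Lemma polarization x y : inner x y = 4^-1 *
  ((nsq (y + x))%:C - (nsq (y - x))%:C
   + 'i * ((nsq (y + 'i *: x))%:C - (nsq (y + (- 'i) *: x))%:C)).
Proof.
have ii : 'i * 'i = -1 :> R[i] by rewrite -expr2 sqr_i.
have ci : ('i : R[i])^* = - 'i by rewrite conjCi.
rewrite !nsqD nsqN !innerNl !innerNr !innerZl !innerZr rmorphN/= ci.
rewrite !nsqZ !rmorphM/= !nsqE normrN normCi.
apply: (@mulfI _ 4); first by rewrite pnatr_eq0.
rewrite mulrA mulfV ?mul1r ?pnatr_eq0//.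
(* The products ['i * 'i] stay explicit here because [ring] treats ['i] as an atom; they are
   replaced by [-1] afterwards. *)
transitivity (2 * inner x y - 2 * ('i * 'i) * inner x y + (2 + 2 * ('i * 'i)) *
  inner y x); last by ring.
rewrite ii; ring.
Qed.

Lemma inner_continuousr x : continuous (inner x : E -> R[i]^o).
Proof.
move=> y; apply/cvg_nsqP => e e0.
pose C := nsq x + 1.
have C0 : 0 < C by rewrite ltr_wpDl// nsq_ge0.
have /cvg_nsqP/(_ (e / C)) : (id @ y --> y) by exact: cvg_id.
rewrite divr_gt0// => /(_ isT); apply: filterS => z zy.
rewrite -innerBr (le_lt_trans (nsq_inner_le _ _))//.
rewrite ltr_pdivlMr// in zy; apply: le_lt_trans zy.
by rewrite mulrC ler_wpM2l ?nsq_ge0// lerDl.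
Qed.

End InnerAlgebra.

(** * Projections, Riesz representation, bounded extension *)

Section TotalSets.
Context (R : realType) (E : hilbertType R).
Implicit Types (A P : set E) (x y : E).

Lemma lin_span_sub A : A `<=` lin_span A.
Proof.
move=> x Ax; exists 1%N, (fun=> 1), (fun=> x); split=> //.
by rewrite big_ord1 scale1r.
Qed.

Lemma lin_spanP A (a : R[i]) x y :
  lin_span A x -> lin_span A y -> lin_span A (a *: x + y).
Proof.
move=> [n [c [v [Av ->]]]] [m [d [w [Aw ->]]]].
exists (n + m)%N,
  (fun i : 'I_(n + m) =>
     match fintype.split i with inl j => a * c j | inr j => d j end),
  (fun i : 'I_(n + m) =>
     match fintype.split i with inl j => v j | inr j => w j end); split.
  by move=> i; case: fintype.split.
rewrite big_split_ord/= scaler_sumr; congr (_ + _); apply: eq_bigr => i _.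
  by rewrite (unsplitK (inl i)) scalerA.
by rewrite (unsplitK (inr i)).
Qed.

Lemma lin_span0 A : lin_span A 0.
Proof.
exists 0%N, (fun=> 0), (fun=> 0); split; first by case.
by rewrite big_ord0.
Qed.

Lemma lin_span_min A P : A `<=` P -> P 0 ->
  (forall (a : R[i]) x y, P x -> P y -> P (a *: x + y)) -> lin_span A `<=` P.
Proof.
move=> AP P0 Plin x [n [c [v [Av ->]]]].
elim/big_rec : _ => // i y _ Py; apply: Plin => //; exact/AP/Av.
Qed.

(** Induction principle for total sets: such a [P] is a closed subspace containing [A]. Most
    identities and inclusions below are extended from kernels or elementary tensors in this way. *)
Lemma total_ind A P : total_set A -> A `<=` P -> P 0 ->
  (forall (a : R[i]) x y, P x -> P y -> P (a *: x + y)) -> closed P ->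
  forall x, P x.
Proof.
move=> tA AP P0 Plin cP x; have : closure (lin_span A) x by rewrite tA.
move=> h; apply: cP; exact: (closureS (lin_span_min AP P0 Plin)) _ h.
Qed.

Lemma closure_lin_span0 A : closure (lin_span A) 0.
Proof. by apply: subset_closure; exact: lin_span0. Qed.

Lemma closure_lin_spanP A (a : R[i]) x y :
  closure (lin_span A) x -> closure (lin_span A) y ->
  closure (lin_span A) (a *: x + y).
Proof.
move=> /closure_nsqP xA /closure_nsqP yA; apply/closure_nsqP => e e0.
(* [nsqD_le] doubles both errors, so each may contribute [e / 4]; the summand [1] keeps the divisor
   positive when [a] is zero. *)
have C0 : 0 < 4 * (nsq a + 1) by rewrite mulr_gt0// ltr_wpDl// nsq_ge0.
have [x' Ax' xx'] := xA (e / (4 * (nsq a + 1))) ltac:(by rewrite divr_gt0).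
have [y' Ay' yy'] := yA (e / 4) ltac:(by rewrite divr_gt0).
exists (a *: x' + y'); first exact: lin_spanP.
rewrite opprD addrACA -scalerBr (le_lt_trans (nsqD_le _ _))// nsqZ.
rewrite ltr_pdivlMr// in xx'; rewrite ltr_pdivlMr// in yy'.
have := nsq_ge0 (x - x'); have := nsq_ge0 a; nra.
Qed.

Lemma total_subclosure A B :
  total_set A -> A `<=` closure (lin_span B) -> total_set B.
Proof.
move=> tA AB; apply/seteqP; split=> // x _; apply: (total_ind tA AB).
- exact: closure_lin_span0.
- exact: closure_lin_spanP.
- exact: closed_closure.
Qed.

Lemma closed_inner0 x : closed [set y | inner x y = 0].
Proof.
rewrite [X in closed X](_ : _ = (inner x : E -> R[i]^o) @^-1` [set z | nsq z <= 0]).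
  apply: preimage_closed; last exact: closed_nsq_le.
  by move=> y _; exact: inner_continuousr.
apply/seteqP; split=> y /=; first by move=> ->; rewrite nsq0.
by move=> h; apply/eqP; rewrite -nsq_eq0 eq_le h nsq_ge0.
Qed.

(* The element of [closure M] nearest to [x] is obtained from the parallelogram
   identity; what is left of [x] is orthogonal to [A]. *)
Lemma orthogonal_total A :
  (forall x, (forall a, A a -> inner a x = 0) -> x = 0) -> total_set A.
Proof.
move=> h; apply/seteqP; split=> // x _; set M := lin_span A.
pose D := [set nsq (x - s) | s in M].
have hinf : has_inf D.
  split; first by exists (nsq (x - 0)); exists 0 => //; exact: lin_span0.
  by exists 0 => _ [s _ <-]; exact: nsq_ge0.
have infD s : M s -> inf D <= nsq (x - s).
  by move=> Ms; apply: ge_inf; [case: hinf|exists s].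
have /boolp.choice[s hs] : forall n : nat, exists y, M y /\
    nsq (x - y) < inf D + n.+1%:R^-1.
  move=> n.
  have e0 : 0 < n.+1%:R^-1 :> R by rewrite invr_gt0.
  by have [_ [y My <-] ltD] := inf_adherent e0 hinf; exists y.
(* The midpoint of [s n] and [s m] lies in [M], so its squared distance to [x] is at least [inf D];
   the parallelogram identity then bounds the gap. *)
have dist n m : nsq (s n - s m) < 2 * n.+1%:R^-1 + 2 * m.+1%:R^-1.
  have := parallelogram (x - s m) (x - s n).
  have -> : x - s m - (x - s n) = s n - s m by rewrite opprB addrC addrA subrK.
  move=> hp.
  have mid : M (2^-1 *: (s n + s m)).
    rewrite -[_ *: _]addr0; apply: lin_spanP; last exact: lin_span0.
    by rewrite -[s n]scale1r; apply: lin_spanP; case: (hs n); case: (hs m).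
  have /infD : M (2^-1 *: (s n + s m)) by [].
  have -> : x - 2^-1 *: (s n + s m) = 2^-1 *: ((x - s m) + (x - s n)).
    rewrite addrACA -opprD scalerBr -mulr2n -[x *+ 2]scaler_nat scalerA mulVf
      ?pnatr_eq0//.
    by rewrite scale1r [s m + _]addrC.
  rewrite nsqZ (_ : nsq _ = 4^-1); last first.
    apply: (@complexI R); rewrite nsqE normfV normr_nat exprVn -natrX.
    by rewrite fmorphV rmorph_nat.
  case: (hs n) (hs m) hp => _ + [_ +];
    move: (_^-1) (_^-1) (nsq _) (nsq _) (nsq _) (nsq _) => a1 a2 a3 a4 a5 a6; lra.
have cs : cvgn s.
  apply: nsq_cauchy => e e0; exists (Num.truncn (4 / e)) => n m nN mN.
  apply: lt_le_trans (dist n m) _.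
  have inve k : (Num.truncn (4 / e) <= k)%N -> k.+1%:R^-1 <= e / 4.
    move=> kN; rewrite -[e / 4]invrK lef_pV2 ?posrE ?invr_gt0 ?divr_gt0//.
    rewrite invf_div ltW//; apply: lt_le_trans (truncnS_gt _) _.
    by rewrite ler_nat ltnS.
  move: (inve _ nN) (inve _ mN); move: (n.+1%:R^-1) (m.+1%:R^-1) => p q; lra.
have clp : closure M (limn s).
  apply/closure_nsqP => e e0; move: cs => /cvg_nsqP/(_ e e0)[N _ hN].
  by exists (s N); [case: (hs N)|rewrite nsqB; apply: hN => /=].
set p := limn s in clp.
have pd : nsq (x - p) <= inf D.
  apply/ler_addgt0Pr => e e0.
  have sp : x - s n @[n --> \oo] --> x - p by apply: cvgB => //; exact: cvg_cst.
  apply: (@closed_cvg _ _ _ _ _ _ (@closed_nsq_le _ E (inf D + e)) _ _ sp).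
  exists (Num.truncn e^-1) => // n /= nN; apply: ltW.
  apply: (lt_le_trans (hs n).2);
    rewrite lerD2l -[e]invrK lef_pV2 ?posrE ?invr_gt0//.
  by rewrite ltW//; apply: lt_le_trans (truncnS_gt _) _; rewrite ler_nat ltnS.
suff -> : x = p by [].
apply/eqP; rewrite -subr_eq0; apply/eqP/h => a Aa; set u := x - p.
have [->|a0] := eqVneq a 0; first by rewrite inner0l.
have na0 : 0 < nsq a by rewrite lt_def nsq_eq0 a0 nsq_ge0.
(* The optimal coefficient: moving from [p] to [p + c *: a] lowers the squared distance to [x] by
   the squared modulus of [inner a u] over [nsq a], which minimality forces to vanish. *)
pose c := inner a u / (nsq a)%:C.
have cE : c^* = inner u a / (nsq a)%:C.
  rewrite rmorphM/= inner_conj fmorphV/= (CrealP _)//.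
  by rewrite nsqE rpredX// normr_real.
have naE0 : 0 < (nsq a)%:C by rewrite nsqE exprn_gt0 ?normr_gt0.
have naE := lt0r_neq0 naE0.
(* [p + c *: a] is only in the closure of [M], so it is approximated by points of [M]. The triangle
   inequality for square roots is used because [nsqD_le] would lose a factor. *)
have umin : inf D <= nsq (u - c *: a).
  have : closure M (p + c *: a).
    by rewrite addrC; apply: closure_lin_spanP => //;
      exact/subset_closure/lin_span_sub.
  move=> hc; rewrite /u -addrA -opprD.
  suff : forall e, 0 < e -> Num.sqrt (inf D) <= Num.sqrt (nsq (x - (p + c *: a)))
    + e.
    by move/ler_addgt0Pr; rewrite ler_sqrt// nsq_ge0.
  move=> e e0; move/closure_nsqP : hc => /(_ _ (exprn_gt0 2 e0))[b Mb pb].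
  have := infD _ Mb; rewrite -[x - b](subrKA (p + c *: a)) => hb.
  rewrite (le_trans (ler_wsqrtr hb))// (le_trans (sqrt_nsqD _ _))// lerD2l.
  by rewrite -[leRHS]ger0_norm ?(ltW e0)// -sqrtr_sqr ler_wsqrtr ?(ltW pb).
have := le_trans pd umin;
  rewrite -/u -lecR [(nsq (_ - _ *: _))%:C]nsqD nsqN nsqZ innerNl innerNr.
rewrite innerZl innerZr -opprD cE.
rewrite [(nsq c * _)%:C]rmorphM/= [(nsq c)%:C]nsqE normCK cE /c.
move=> hle; apply/eqP; rewrite -normr_eq0 -sqrf_eq0 normCK inner_conj.
have : inner a u * inner u a / (nsq a)%:C <= 0.
  rewrite -subr_ge0 sub0r; move: hle; rewrite -subr_ge0; congr (0 <= _).
  by field.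
rewrite pmulr_lle0 ?invr_gt0//.
move=> h0; apply/eqP/le_anti; rewrite h0/= -(inner_conj a u) -normCK.
by rewrite exprn_ge0.
Qed.

End TotalSets.

Section BoundedOps.
Context (R : realType).
Implicit Types E F G : hilbertType R.

Lemma bopext E F (A B : 'B(E, F)) : (forall x, A x = B x) -> A = B.
Proof. by move=> AB; apply/val_inj/funext. Qed.

Lemma bopD E F (A : 'B(E, F)) x y : A (x + y) = A x + A y.
Proof. exact: linearD. Qed.
Lemma bopZ E F (A : 'B(E, F)) (a : R[i]) x : A (a *: x) = a *: A x.
Proof. exact: linearZ. Qed.
Lemma bop_sum E F (A : 'B(E, F)) (I : Type) (r : seq I) (P : pred I) (h : I -> E) :
  A (\sum_(i <- r | P i) h i) = \sum_(i <- r | P i) A (h i).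
Proof. exact: linear_sum. Qed.

Lemma bop_of_bound E F (f : E -> F) (C : R) : linear f ->
  (forall x, nsq (f x) <= C * nsq x) -> exists A : 'B(E, F), forall x, A x = f x.
Proof.
move=> lin bnd.
suff fb : f \in @bounded_op R E F by exists (Bop fb).
apply/asboolP; split=> // x; apply/cvg_nsqP => e e0.
have C0 : 0 < `|C| + 1 by rewrite ltr_wpDl.
have /cvg_nsqP/(_ (e / (`|C| + 1))) : (id @ x --> x) by exact: cvg_id.
rewrite divr_gt0// => /(_ isT); apply: filterS => z zx.
have -> : f z - f x = f (z - x).
  by rewrite addrC -scaleN1r -lin scaleN1r addrC.
rewrite ltr_pdivlMr// in zx; apply: le_lt_trans (bnd _) _; apply: le_lt_trans zx.
by rewrite mulrC ler_wpM2l ?nsq_ge0// (le_trans (ler_norm _))// lerDl.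
Qed.

Lemma bop_bound E F (A : 'B(E, F)) :
  exists2 C : R, 0 < C & forall x, nsq (A x) <= C * nsq x.
Proof.
have /linear_boundedP/pinfty_ex_gt0[r /= r0 hr] :
  bounded_near A (nbhs (0 : E)).
  by apply: continuous_linear_bounded; exact: bop_continuous.
have rE : (complex.Re r)%:C = r by rewrite RRe_real// gtr0_real.
exists (complex.Re r ^+ 2); first by rewrite exprn_gt0// -ltcR rE.
move=> x; rewrite -lecR rmorphM/= rmorphXn/= rE !nsqE -exprMn.
by rewrite lerXn2r ?nnegrE ?mulr_ge0 ?(ltW r0).
Qed.

Lemma closed_bop_eq E F (A B : 'B(E, F)) : closed [set x | A x = B x].
Proof.
rewrite [X in closed X](_ : _ = (A - B : 'B(E, F)) @^-1` [set z | nsq z <= 0]).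
  apply: preimage_closed; last exact: closed_nsq_le.
  by move=> y _; exact: bop_continuous.
apply/seteqP; split=> y h.
  by change (nsq (A y - B y) <= 0); rewrite h subrr nsq0.
by apply/eqP; rewrite -subr_eq0 -nsq_eq0 eq_le nsq_ge0 andbT.
Qed.

Lemma total_bopext E F (A B : 'B(E, F)) (S : set E) : total_set S ->
  (forall x, S x -> A x = B x) -> A = B.
Proof.
move=> tS AB; apply: bopext; apply: (total_ind tS).
- exact: AB.
- by rewrite /= !linear0.
- by move=> a x y /= Hx Hy; rewrite !bop_linear Hx Hy.
- exact: closed_bop_eq.
Qed.

(** Either some nonzero [u] is orthogonal to the kernel of [phi], and a multiple of [u] represents
    [phi]; or the kernel is total, and being closed it is the whole space, so that [0] represents
    [phi]. *)
Lemma riesz E (phi : E -> R[i]^o) (C : R) : linear phi ->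
  (forall x, nsq (phi x) <= C * nsq x) -> exists v, forall x, phi x = inner v x.
Proof.
move=> lin bnd; pose K := [set x | phi x = 0].
have phiB x y : phi (x - y) = phi x - phi y.
  by rewrite addrC -scaleN1r lin scaleN1r addrC.
have phiZ a x : phi (a *: x) = a * phi x.
  by have := lin a x 0; rewrite -{2}(subrr x) phiB subrr !addr0.
have [[u uK u0]|noperp] := pselect (exists2 u, forall x, K x -> inner x u = 0 & u
  != 0).
  have pu : phi u != 0.
    apply: contra_neq u0 => /uK; rewrite inner_nsq => /(@complexI R _ 0)/eqP.
    by rewrite nsq_eq0 => /eqP.
  have nu : (nsq u)%:C != 0 by rewrite nsqE sqrf_eq0 normr_eq0.
  exists ((phi u / (nsq u)%:C)^* *: u) => x; rewrite innerZl conjCK.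
  have : K (x - phi x / phi u *: u) by rewrite /K/= phiB phiZ mulfVK// subrr.
  move=> /uK; rewrite -inner_conj => /eqP; rewrite conjC_eq0 => /eqP.
  rewrite innerBr innerZr inner_nsq => /eqP; rewrite subr_eq0 => /eqP ->.
  by field; rewrite pu nu.
exists 0 => x; rewrite inner0l.
have tK : total_set K.
  apply: orthogonal_total => u uK; apply: contrapT => /eqP u0; apply: noperp.
  by exists u.
apply: (@total_ind _ _ _ K tK) => //.
- by rewrite /K/= -(subrr x) phiB subrr.
- by move=> a y z py pz; rewrite /K/= lin py pz scaler0 addr0.
- move=> y /closure_nsqP yK; apply/eqP; rewrite -nsq_eq0 eq_le nsq_ge0 andbT.
  apply/ler_addgt0Pr => e e0; rewrite add0r.
  have C0 : 0 < `|C| + 1 by rewrite ltr_wpDl.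
  have [z Kz yz] := yK (e / (`|C| + 1)) ltac:(by rewrite divr_gt0).
  rewrite -[phi y]subr0 -Kz -phiB (le_trans (bnd _))//.
  rewrite ltr_pdivlMr// in yz; apply/ltW; apply: le_lt_trans yz.
  by rewrite mulrC ler_wpM2l ?nsq_ge0// (le_trans (ler_norm _))// lerDl.
Qed.

Lemma adjoint_exists E F (A : 'B(E, F)) :
  exists B : 'B(F, E), forall x y, inner (A x) y = inner x (B y).
Proof.
have [C C0 bnd] := bop_bound A.
have /boolp.choice[B BE] : forall y, exists v, forall x, inner y (A x) = inner v x.
  move=> y; apply: (@riesz E (fun x => inner y (A x)) (nsq y * C)).
    by move=> a u v; rewrite linearP innerDr innerZr.
  move=> x; rewrite (le_trans (nsq_inner_le _ _))// -mulrA ler_wpM2l ?nsq_ge0//.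
have BE' x y : inner (A x) y = inner x (B y) by rewrite -inner_conj BE inner_conj.
have linB : linear B.
  move=> a u v; apply: inner_ext => z.
  by rewrite innerDr innerZr -!BE' innerDr innerZr.
have [B' B'E] : exists B' : 'B(F, E), forall y, B' y = B y.
  apply: (bop_of_bound (C := C)) => // y.
  have [->|By0] := eqVneq (B y) 0; first by rewrite nsq0 mulr_ge0 ?nsq_ge0 ?ltW.
  have nBy : 0 < nsq (B y) by rewrite lt_def nsq_eq0 By0 nsq_ge0.
  (* [nsq (B y)] is the value of [inner (A (B y)) y]; Cauchy-Schwarz and the bound on [A] leave one
     factor [nsq (B y)] to cancel. *)
  have h : nsq (B y) ^+ 2 <= C * nsq (B y) * nsq y.
    apply: (@le_trans _ _ (nsq (inner (A (B y)) y))).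
      rewrite BE' inner_nsq -lecR [leRHS]nsqE ger0_norm ?ler0c ?nsq_ge0//.
      by rewrite rmorphXn.
    by rewrite (le_trans (nsq_inner_le _ _))// ler_wpM2r ?nsq_ge0.
  by rewrite -(ler_pM2l nBy) -expr2 (le_trans h)// mulrCA mulrA.
by exists B' => x y; rewrite B'E.
Qed.

Lemma adjointE E F (A : 'B(E, F)) x y : inner x (adjoint A y) = inner (A x) y.
Proof.
rewrite /adjoint; case: xgetP => [B _ <-//|no].
by have [B /no] := adjoint_exists A.
Qed.

Lemma adjointEl E F (A : 'B(E, F)) x y : inner (adjoint A y) x = inner y (A x).
Proof. by rewrite -inner_conj adjointE inner_conj. Qed.

(** The closure of a densely defined bounded linear relation is the graph of a bounded operator.
    With a relation in place of a function, single-valuedness comes out of the bound and need not be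
    checked beforehand. *)
Lemma relation_extension E F (G : E -> F -> Prop) (C : R) :
  (forall (a : R[i]) x y x' y', G x y -> G x' y' -> G (a *: x + x') (a *: y +
    y')) ->
  (forall x y, G x y -> nsq y <= C * nsq x) ->
  (forall x e, 0 < e -> exists x' y', G x' y' /\ nsq (x - x') < e) ->
  exists A : 'B(E, F), forall x y, G x y -> A x = y.
Proof.
move=> Glin Gbnd Gdense.
wlog C0 : C Gbnd / 0 < C.
  move=> /(_ (`|C| + 1)); apply; last by rewrite ltr_wpDl.
  move=> x y Gxy; rewrite (le_trans (Gbnd _ _ Gxy))// ler_wpM2r ?nsq_ge0//.
  by rewrite (le_trans (ler_norm _))// lerDl.
pose Gb x y := forall e, 0 < e -> exists x' y',
  [/\ G x' y', nsq (x - x') < e & nsq (y - y') < e].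
have GbS x y : G x y -> Gb x y.
  by move=> Gxy e e0; exists x, y; rewrite !subrr !nsq0.
have Gblin (a : R[i]) x y x' y' :
    Gb x y -> Gb x' y' -> Gb (a *: x + x') (a *: y + y').
  move=> Gxy Gxy' e e0.
  have D0 : 0 < 4 * (nsq a + 1) by rewrite mulr_gt0// ltr_wpDl// nsq_ge0.
  have [u [v [Guv xu yv]]] := Gxy (e / (4 * (nsq a + 1))) ltac:(by rewrite
    divr_gt0).
  have [u' [v' [Guv' xu' yv']]] := Gxy' (e / 4) ltac:(by rewrite divr_gt0).
  exists (a *: u + u'), (a *: v + v'); split; first exact: Glin.
    rewrite opprD addrACA -scalerBr (le_lt_trans (nsqD_le _ _))// nsqZ.
    rewrite ltr_pdivlMr// in xu; rewrite ltr_pdivlMr// in xu'.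
    have := nsq_ge0 (x - u); have := nsq_ge0 a; nra.
  rewrite opprD addrACA -scalerBr (le_lt_trans (nsqD_le _ _))// nsqZ.
  rewrite ltr_pdivlMr// in yv; rewrite ltr_pdivlMr// in yv'.
  have := nsq_ge0 (y - v); have := nsq_ge0 a; nra.
(* The factor 4 comes from two uses of [nsqD_le]. It is harmless: the bound only serves to show that
   [Gb] is single-valued and its operator continuous. *)
have Gbbnd x y : Gb x y -> nsq y <= 4 * C * nsq x.
  move=> Gxy; apply/ler_addgt0Pr => e e0.
  have D0 : 0 < 2 + 4 * C by rewrite ltr_wpDl// mulr_gt0.
  have [u [v [Guv xu yv]]] := Gxy (e / (2 + 4 * C)) ltac:(by rewrite divr_gt0).
  have := nsqD_le (y - v) v; rewrite subrK.
  have := nsqD_le (u - x) x; rewrite subrK nsqB.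
  have := Gbnd _ _ Guv.
  rewrite ltr_pdivlMr// in xu; rewrite ltr_pdivlMr// in yv.
  move=> h1 h2 h3; have h4 : C * nsq u <= C * (2 * nsq (x - u) + 2 * nsq x).
    by apply: ler_wpM2l => //; exact: ltW.
  have := mulr_ge0 (ltW C0) (nsq_ge0 (x - u)); have := nsq_ge0 (x - u); nra.
(* [Gb] is defined everywhere: when first components in [G] converge to [x], the bound makes the
   second components a Cauchy sequence. *)
have /boolp.choice[A GA] : forall x, exists y, Gb x y.
  move=> x.
  have /boolp.choice[u hu] : forall n : nat, exists p : E * F,
      G p.1 p.2 /\ nsq (x - p.1) < n.+1%:R^-1.
    move=> n; have [|x' [y' [Gxy xx']]] := Gdense x n.+1%:R^-1;
      first by rewrite invr_gt0.
    by exists (x', y').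
  have dist n m : nsq ((u n).2 - (u m).2) <= C * (2 * n.+1%:R^-1 + 2 * m.+1%:R^-1).
    have : G ((u n).1 - (u m).1) ((u n).2 - (u m).2).
      rewrite addrC -scaleN1r [X in G _ X]addrC -[- (u m).2]scaleN1r.
      by apply: Glin; [case: (hu m)|case: (hu n)].
    move=> /Gbnd h; rewrite (le_trans h)// ler_wpM2l ?(ltW C0)//.
    have -> : (u n).1 - (u m).1 = (x - (u m).1) - (x - (u n).1).
      by rewrite opprB [RHS]addrC addrA subrK.
    rewrite (le_trans (nsqD_le _ _))// nsqN addrC.
    apply: lerD; rewrite ler_wpM2l// ltW//.
      by case: (hu n).
    by case: (hu m).
  have cu : cvgn (fun n => (u n).2).
    apply: nsq_cauchy => e e0; exists (Num.truncn (4 * C / e)) => n m nN mN.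
    apply: le_lt_trans (dist n m) _; rewrite -ltr_pdivlMl// mulrC.
    have inve k : (Num.truncn (4 * C / e) <= k)%N -> k.+1%:R^-1 < e / C / 4.
      move=> kN; rewrite -[e / C / 4]invrK ltf_pV2 ?posrE ?invr_gt0 ?divr_gt0//.
      rewrite (_ : (_ / 4)^-1 = 4 * C / e); last by field; rewrite gt_eqF//= gt_eqF.
      apply: (lt_le_trans (truncnS_gt _)).
      by rewrite ler_nat ltnS.
    move: (inve _ nN) (inve _ mN); move: (n.+1%:R^-1) (m.+1%:R^-1) => p q.
    by lra.
  exists (limn (fun n => (u n).2)) => e e0.
  move: cu => /cvg_nsqP/(_ e e0)[N _ hN].
  pose n := maxn N (Num.truncn e^-1).
  exists (u n).1, (u n).2; split; first by case: (hu n).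
    apply: (lt_le_trans (hu n).2); rewrite -[e]invrK lef_pV2 ?posrE ?invr_gt0//.
    rewrite ltW//; apply: lt_le_trans (truncnS_gt _) _.
    by rewrite ler_nat ltnS leq_maxr.
  by rewrite nsqB; apply: hN => /=; rewrite leq_maxl.
have Gbu x y y' : Gb x y -> Gb x y' -> y = y'.
  move=> Gxy Gxy'; have := Gblin (-1) _ _ _ _ Gxy Gxy'.
  rewrite !scaleN1r addNr => /Gbbnd; rewrite nsq0 mulr0 => h.
  by apply/eqP; rewrite eq_sym -subr_eq0 addrC -nsq_eq0 eq_le h nsq_ge0.
have [A' A'E] : exists A' : 'B(E, F), forall x, A' x = A x.
  apply: (bop_of_bound (C := 4 * C)) => [a x y|x]; last exact: Gbbnd.
  by apply: (Gbu (a *: x + y)); [exact: GA|exact: Gblin].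
by exists A' => x y Gxy; rewrite A'E; apply: (Gbu x); [exact: GA|exact: GbS].
Qed.

(** The bound also gives well-definedness: a vanishing combination of the [k i] forces the same
    combination of the [g i] to vanish. The relation pairs combinations having the same
    coefficients. *)
Lemma bop_extension E F (I : Type) (k : I -> E) (g : I -> F) (C : R) :
  total_set (range k) ->
  (forall n (c : 'I_n -> R[i]) (i : 'I_n -> I),
    nsq (\sum_j c j *: g (i j)) <= C * nsq (\sum_j c j *: k (i j))) ->
  exists A : 'B(E, F), forall i, A (k i) = g i.
Proof.
move=> tk bnd.
pose G x y := exists n (c : 'I_n -> R[i]) (i : 'I_n -> I),
  x = \sum_j c j *: k (i j) /\ y = \sum_j c j *: g (i j).
have [|x y [n [c [i [-> ->]]]]||A AE] := @relation_extension E F G C.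
- move=> a x y x' y' [n [c [v [-> ->]]]] [m [d [w [-> ->]]]].
  exists (n + m)%N,
    (fun i : 'I_(n + m) =>
       match fintype.split i with inl j => a * c j | inr j => d j end),
    (fun i : 'I_(n + m) =>
       match fintype.split i with inl j => v j | inr j => w j end).
  rewrite !big_split_ord/= !scaler_sumr; split; congr (_ + _);
    apply: eq_bigr => i _.
  + by rewrite (unsplitK (inl i)) scalerA.
  + by rewrite (unsplitK (inr i)).
  + by rewrite (unsplitK (inl i)) scalerA.
  + by rewrite (unsplitK (inr i)).
- exact: bnd.
- move=> x e e0; have /closure_nsqP/(_ e e0)[x' [n [c [v [kv ->]]]] xx'] :
    closure (lin_span (range k)) x by rewrite tk.
  have /boolp.choice[i ki] : forall j, exists i, k i = v j.
    by move=> j; have [i _ <-] := kv j; exists i.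
  exists (\sum_j c j *: v j), (\sum_j c j *: g (i j)); split=> //.
  by exists n, c, i; split=> //; apply: eq_bigr => j _; rewrite ki.
- by exists A => i; apply: AE; exists 1%N, (fun=> 1), (fun=> i);
    rewrite !big_ord1 !scale1r.
Qed.

End BoundedOps.

(** * Orthonormal systems and Parseval's identity *)

Section OrthoSystems.
Context (R : realType) (E : hilbertType R).
Implicit Types (g : nat -> E) (x y : E).

(* Zero vectors are allowed, so that systems spanning a finite-dimensional space
   are also indexed by [nat]. *)
Definition orthosystem g : Prop :=
  (forall i j, i != j -> inner (g i) (g j) = 0) /\
  (forall i, g i = 0 \/ nsq (g i) = 1).

Definition fourier_sum g n x := \sum_(i < n) inner (g i) x *: g i.

Lemma fourier_sum_linear g n : linear (fourier_sum g n).
Proof.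
move=> a x y; rewrite /fourier_sum scaler_sumr -big_split/=; apply: eq_bigr => i _.
by rewrite innerDr innerZr scalerDl scalerA.
Qed.

(** Only indices below [n] are constrained, so that this applies inside Gram-Schmidt, where
    orthogonality is known just for the earlier vectors. *)
Lemma fourier_sum_orth g n x (j : 'I_n) :
  (forall i : 'I_n, i != j -> inner (g j) (g i) = 0) ->
  g j = 0 \/ nsq (g j) = 1 ->
  inner (g j) (x - fourier_sum g n x) = 0.
Proof.
move=> orth [->|gj]; first by rewrite inner0l.
rewrite innerBr inner_sumr (bigD1 j)//= big1 => [|i ij]; last first.
  by rewrite innerZr orth// mulr0.
by rewrite innerZr inner_nsq gj mulr1 addr0 subrr.
Qed.

Section Ortho.
Variables (g : nat -> E) (og : orthosystem g).

Lemma fourier_sum_pythagoras n x :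
  nsq x = \sum_(i < n) nsq (inner (g i) x) + nsq (x - fourier_sum g n x).
Proof.
have orth (j : 'I_n) : inner (g j) (x - fourier_sum g n x) = 0.
  apply: fourier_sum_orth; last by case: og.
  by move=> i ij; apply: og.1; rewrite eq_sym.
have sorth : inner (fourier_sum g n x) (x - fourier_sum g n x) = 0.
  by rewrite inner_suml big1// => i _; rewrite innerZl orth mulr0.
have sx : inner (fourier_sum g n x) x = (\sum_(i < n) nsq (inner (g i) x))%:C.
  rewrite inner_suml rmorph_sum/=; apply: eq_bigr => i _.
  by rewrite innerZl nsqE normCK mulrC.
apply: (@complexI R); rewrite rmorphD/= -sx -{1}[x](subrK (fourier_sum g n x)).
rewrite nsqD sorth -(inner_conj (fourier_sum g n x)) sorth rmorph0 !addr0 addrC.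
congr (_ + _); rewrite -inner_nsq; apply/eqP; rewrite -subr_eq0 -opprB oppr_eq0.
by rewrite -innerBr sorth.
Qed.

Lemma nsq_fourier_sumB_le n x : nsq (x - fourier_sum g n x) <= nsq x.
Proof.
rewrite [leRHS](fourier_sum_pythagoras n) lerDr; apply: sumr_ge0 => i _.
exact: nsq_ge0.
Qed.

Hypothesis tg : total_set (range g).

(** The vectors with this property form a subspace, closed because the remainders
    [x - fourier_sum g n x] are bounded by [x] uniformly in [n]. For [x = g j] the sums equal [g j]
    once [n] exceeds [j]. *)
Lemma fourier_sum_cvg x : fourier_sum g n x @[n --> \oo] --> x.
Proof.
pose P := [set x | forall e : R, 0 < e -> exists N, forall n, (N <= n)%N ->
  nsq (x - fourier_sum g n x) < e].
suff Px : P x.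
  by apply/cvg_nsqP => e /Px[N hN]; exists N => // n Nn; rewrite nsqB; exact: hN.
apply: (@total_ind _ _ _ P tg).
- move=> _ [j _ <-] e e0; exists j.+1 => n jn.
  rewrite [fourier_sum _ _ _](_ : _ = g j) ?subrr ?nsq0//.
  rewrite /fourier_sum (bigD1 (Ordinal jn))//= big1 => [|i ij]; last first.
    by rewrite og.1 ?scale0r.
  rewrite addr0; case: (og.2 j) => [->|gj]; first by rewrite scaler0.
  by rewrite inner_nsq gj scale1r.
- move=> e e0; exists 0%N => n _; rewrite /fourier_sum big1 ?subrr ?nsq0// => i _.
  by rewrite inner0r scale0r.
- move=> a y z Py Pz e e0.
  have D0 : 0 < 4 * (nsq a + 1) by rewrite mulr_gt0// ltr_wpDl// nsq_ge0.
  have [N hN] := Py (e / (4 * (nsq a + 1))) ltac:(by rewrite divr_gt0).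
  have [M hM] := Pz (e / 4) ltac:(by rewrite divr_gt0).
  exists (maxn N M) => n; rewrite geq_max => /andP[/hN hy /hM hz].
  rewrite fourier_sum_linear opprD addrACA -scalerBr.
  rewrite (le_lt_trans (nsqD_le _ _))// nsqZ.
  rewrite ltr_pdivlMr// in hy; rewrite ltr_pdivlMr// in hz.
  have := nsq_ge0 (y - fourier_sum g n y); have := nsq_ge0 a; nra.
- move=> y /closure_nsqP yP e e0.
  have [z Pz yz] := yP (e / 4) ltac:(by rewrite divr_gt0).
  have [N hN] := Pz (e / 4) ltac:(by rewrite divr_gt0).
  exists N => n /hN hz.
  have -> : y - fourier_sum g n y =
      ((y - z) - fourier_sum g n (y - z)) + (z - fourier_sum g n z).
    have -> : fourier_sum g n (y - z) = fourier_sum g n y - fourier_sum g n z.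
      by rewrite [y - z]addrC -scaleN1r fourier_sum_linear scaleN1r addrC.
    by rewrite opprB addrACA subrK [_ - _ - _]addrAC subrr sub0r.
  rewrite (le_lt_trans (nsqD_le _ _))//.
  have := nsq_fourier_sumB_le n (y - z); lra.
Qed.

End Ortho.

Lemma gram_schmidt (y : nat -> E) :
  exists2 g, orthosystem g & forall n, lin_span (range g) (y n).
Proof.
(* If [y n] depends on its predecessors, [z] is zero and so is the new vector: the zero vectors
   allowed in an [orthosystem] arise here. *)
pose step (g : nat -> E) n :=
  let z := y n - fourier_sum g n (y n) in `|z|^-1 *: z.
(* [gs n] holds the first [n] vectors and is zero beyond; [g] reads off entry [k] at stage [k.+1],
   where it has just been created. *)
pose gs := fix gs n k := if n is m.+1 then
  (if k == m then step (gs m) m else gs m k) else 0.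
pose g k := gs k.+1 k.
have gsE n k : (k < n)%N -> gs n k = g k.
  elim: n => // n IH; rewrite ltnS leq_eqVlt => /predU1P[->//|kn].
  by rewrite -IH//= ltn_eqF.
have gE n : g n = step g n.
  rewrite {1}/g/= eqxx /step;
    rewrite (_ : fourier_sum (gs n) _ _ = fourier_sum g n (y n))//.
  by apply: eq_bigr => i _; rewrite gsE.
have normal n : g n = 0 \/ nsq (g n) = 1.
  rewrite gE /step/=; have [->|z0] := eqVneq (y n - fourier_sum g n (y n)) 0.
    by left; rewrite scaler0.
  right; apply: (@complexI R);
    rewrite nsqE normrZ normfV normr_id mulVf ?normr_eq0//.
  by rewrite expr1n.
have orth n : forall i, (i < n)%N -> inner (g i) (g n) = 0.
  elim/ltn_ind: n => n IH i ni; rewrite [g n]gE innerZr.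
  rewrite (@fourier_sum_orth g n (y n) (Ordinal ni)) ?mulr0// => j /= ji.
  have : (j != i :> nat) by [].
  rewrite neq_ltn => /orP[ltji|ltij]; last exact: IH.
  by rewrite -inner_conj IH ?conjC0.
exists g; first split=> // i j; first rewrite neq_ltn => /orP[|]/orth// h.
  by rewrite -inner_conj h conjC0.
move=> n; rewrite -[y n](subrK (fourier_sum g n (y n))).
have -> : y n - fourier_sum g n (y n) = `|y n - fourier_sum g n (y n)| *: g n.
  rewrite [g n]gE /step/= scalerA.
  have [->|z0] := eqVneq (y n - fourier_sum g n (y n)) 0; first by rewrite scaler0.
  by rewrite mulfV ?normr_eq0// scale1r.
apply: lin_spanP; first by apply: lin_span_sub; exists n.
rewrite /fourier_sum; elim/big_rec : _ => [|i x _ hx]; first exact: lin_span0.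
by apply: lin_spanP => //; apply: lin_span_sub; exists i.
Qed.

End OrthoSystems.

(** * Square sums in the extended reals *)

Section SquareSums.
Context (R : realType).

(** Values in [\bar R] let sums of nonnegative terms be regrouped and interchanged before anything
    is known to be finite. *)
Definition sqsum (V : normedZmodType R[i]) (u : nat -> V) : \bar R :=
  (\sum_(0 <= n <oo) (nsq (u n))%:E)%E.

Lemma nsq_real (a : R) : nsq (a%:C : R[i]) = a ^+ 2.
Proof.
apply: (@complexI R); rewrite nsqE real_normK ?rmorphXn//.
by apply/complex_realP; exists a.
Qed.

Lemma cvg_real_complex (T : Type) (F : set_system T) {FF : Filter F}
    (u : T -> R) (l : R) :
  u @ F --> l -> ((u x)%:C : R[i]^o) @[x --> F] --> (l%:C : R[i]^o).
Proof.
move=> /cvgrPdist_lt ul; apply/cvg_nsqP => e e0.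
have se : 0 < Num.sqrt e by rewrite sqrtr_gt0.
have := ul _ se; apply: filterS => x; rewrite distrC => h.
rewrite -rmorphB/= nsq_real -real_normK ?num_real//.
by rewrite -[ltRHS]sqr_sqrtr ?(ltW e0)// ltr_pXn2r ?nnegrE// sqrtr_ge0.
Qed.

Section Seq.
Context (V : normedZmodType R[i]).
Implicit Types u v : nat -> V.

Lemma sqsum_ge0 u : (0 <= sqsum u)%E.
Proof. by apply: nneseries_ge0 => n _ _; rewrite lee_fin nsq_ge0. Qed.

Lemma sqsum_cvgP u (r : R) : sqsum u = r%:E <->
  (\sum_(0 <= i < n) nsq (u i)) @[n --> \oo] --> r.
Proof.
have cu : (\sum_(0 <= i < n) (nsq (u i))%:E)%E @[n --> \oo] --> sqsum u.
  by apply: is_cvg_nneseries => n _ _; rewrite lee_fin nsq_ge0.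
have sE : (fun n => (\sum_(0 <= i < n) (nsq (u i))%:E)%E) =
    (fun n => (\sum_(0 <= i < n) nsq (u i))%:E).
  by apply/funext => n; rewrite sumEFin.
rewrite sE in cu; split=> [ur|ur].
  by rewrite ur in cu; exact: (fine_cvg cu).
apply: (cvg_unique _ cu) => //.
by apply: cvg_EFin; first by apply: nearW.
Qed.

Lemma sqsum_ltyP u : (sqsum u < +oo)%E <-> exists r : R, sqsum u = r%:E.
Proof.
split=> [h|[r ->]]; last exact: ltry.
by exists (fine (sqsum u)); rewrite fineK// ge0_fin_numE// sqsum_ge0.
Qed.

Lemma sqsum_series_cvgP u :
  cvgn (series (fun n => `|u n| ^+ 2 : R[i]^o)) <-> (sqsum u < +oo)%E.
Proof.
have sE : series (fun n => `|u n| ^+ 2 : R[i]^o) =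
    (fun n => (\sum_(0 <= i < n) nsq (u i))%:C).
  apply/funext => n; rewrite /series/= rmorph_sum/=; apply: eq_bigr => i _.
  by rewrite nsqE.
rewrite sE; split=> [/cvg_nsqP h|/sqsum_ltyP[r /sqsum_cvgP ur]]; last first.
  by apply/cvg_ex; exists (r%:C : R[i]^o); exact: cvg_real_complex.
set l := limn _ in h; have [N _ hN] := h 1 ltr01.
pose S n := \sum_(0 <= i < n) nsq (u i).
have Smono : {homo S : n m / (n <= m)%N >-> n <= m}.
  move=> n m nm; rewrite /S (big_cat_nat _ nm)//= lerDl.
  by apply: sumr_ge0 => i _; exact: nsq_ge0.
apply/sqsum_ltyP; exists (limn S); apply/sqsum_cvgP.
(* From rank [N] on, the square of [S n] is at most [2 + 2 * nsq l] by [nsqD_le], and a real number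
   is at most its square plus 1. *)
apply: nondecreasing_is_cvgn => //; exists (3 + 2 * nsq l) => _ [n _ <-].
have /(_ (maxn n N))/= := hN; rewrite leq_maxr => /(_ isT) h1.
apply: (@le_trans _ _ (S (maxn n N))); first by apply: Smono; rewrite leq_maxl.
have := nsqD_le ((S (maxn n N))%:C - l) l; rewrite subrK nsq_real.
by move: h1; rewrite /S; nra.
Qed.

End Seq.
End SquareSums.

(** * Polarization of series, and double sums *)

Section Polarization.
Context (R : realType).

Lemma eq_sqsum (V W : normedZmodType R[i]) (u : nat -> V) (v : nat -> W) :
  (forall n, nsq (u n) = nsq (v n)) -> sqsum u = sqsum v.
Proof. by move=> uv; apply: eq_eseriesr => n _; rewrite uv. Qed.

Lemma sqsum_le (V W : normedZmodType R[i]) (u : nat -> V) (v : nat -> W) (C : R) :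
  0 <= C -> (forall n, nsq (u n) <= C * nsq (v n)) ->
  (sqsum u <= C%:E * sqsum v)%E.
Proof.
move=> C0 uv; rewrite /sqsum -nneseriesZl//; last first.
  by move=> n _; rewrite lee_fin nsq_ge0.
apply: lee_nneseries => n *; first by rewrite lee_fin nsq_ge0.
by rewrite -EFinM lee_fin.
Qed.

Lemma sqsum_le_lty (V W : normedZmodType R[i]) (u : nat -> V) (v : nat -> W) (C :
  R) :
  0 <= C -> (forall n, nsq (u n) <= C * nsq (v n)) ->
  (sqsum v < +oo)%E -> (sqsum u < +oo)%E.
Proof.
move=> C0 uv /sqsum_ltyP[r vr]; apply: le_lt_trans (sqsum_le C0 uv) _.
by rewrite vr -EFinM ltry.
Qed.

Lemma sqsumD_lty (V : normedModType R[i]) (u v : nat -> V) (c : R[i]) :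
  (sqsum u < +oo)%E -> (sqsum v < +oo)%E ->
  (sqsum (fun n => (v n + c *: u n)%R) < +oo)%E.
Proof.
move=> u_fin v_fin.
have : (sqsum (fun n => (v n + c *: u n)%R) <=
    \sum_(0 <= n <oo) ((2 * nsq (v n))%R%:E + (2 * nsq c * nsq (u n))%R%:E))%E.
  apply: lee_nneseries => n *; first by rewrite lee_fin nsq_ge0.
  by rewrite -EFinD lee_fin (le_trans (nsqD_le _ _))// nsqZ mulrA.
rewrite nneseriesD; last 2 first.
- by move=> n _; rewrite lee_fin mulr_ge0 ?nsq_ge0.
- by move=> n _; rewrite lee_fin !mulr_ge0 ?nsq_ge0.
have scale (w : nat -> V) (a : R) : 0 <= a ->
    (\sum_(0 <= n <oo) (a * nsq (w n))%R%:E = a%:E * sqsum w)%E.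
  move=> a0; rewrite /sqsum -nneseriesZl//.
  by move=> n _; rewrite lee_fin nsq_ge0.
rewrite !scale ?mulr_ge0 ?nsq_ge0//; move=> h; apply: le_lt_trans h _.
have [r ->] := (sqsum_ltyP u).1 u_fin; have [s ->] := (sqsum_ltyP v).1 v_fin.
by rewrite -!EFinM -EFinD ltry.
Qed.

Lemma parseval (E : hilbertType R) (g : nat -> E) x :
  orthosystem g -> total_set (range g) ->
  sqsum (fun n => inner (g n) x) = (nsq x)%:E.
Proof.
move=> og tg; apply/sqsum_cvgP.
have /cvg_nsqP h := @fourier_sum_cvg _ _ _ og tg x.
apply/cvgrPdist_lt => e /h; apply: filterS => n; rewrite nsqB => hn.
rewrite big_mkord [nsq x](fourier_sum_pythagoras og n x) addrC addKr.
by rewrite ger0_norm// nsq_ge0.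
Qed.

Lemma cvg_series_unique (a : nat -> R[i]^o) (s t : R[i]^o) :
  series a @ \oo --> s -> series a @ \oo --> t -> s = t.
Proof. by move=> h1 h2; apply: (cvg_unique _ h1 h2). Qed.

Lemma cvg_scalar_mul (T : Type) (F : set_system T) {FF : Filter F} (a : R[i])
    (f : T -> R[i]^o) (b : R[i]^o) :
  f @ F --> b -> (a * f x : R[i]^o) @[x --> F] --> (a * b : R[i]^o).
Proof.
by move=> fb; exact: (@cvgZ R[i] R[i]^o T F FF (fun=> a) f a b (cvg_cst _) fb).
Qed.

(** The polarization formula with [N c] in place of [nsq (y + c *: x)]. It reads [N] only at fourth
    roots of unity, which is why later hypotheses are restricted to [c] of modulus 1. *)
Definition polar (N : R[i] -> R) : R[i] :=
  4^-1 * ((N 1)%:C - (N (-1))%:C + 'i * ((N 'i)%:C - (N (- 'i))%:C)).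

Lemma inner_polar (E : hilbertType R) (x y : E) :
  inner x y = polar (fun c => nsq (y + c *: x)).
Proof. by rewrite /polar scale1r scaleN1r polarization. Qed.

(** Each partial sum is [polar] of partial square sums, so convergence follows from that of four
    real series of nonnegative terms. *)
Lemma polar_series (E : hilbertType R) (u v : nat -> E) (N : R[i] -> R) :
  (forall c, `|c| = 1 -> sqsum (fun n => v n + c *: u n) = (N c)%:E) ->
  series (fun n => inner (u n) (v n) : R[i]^o) @ \oo --> (polar N : R[i]^o).
Proof.
move=> uvN; pose S c n := \sum_(0 <= i < n) nsq (v i + c *: u i).
have SN c : `|c| = 1 -> ((S c n)%:C : R[i]^o) @[n --> \oo] --> ((N c)%:C : R[i]^o).
  by move=> /uvN/sqsum_cvgP; exact: cvg_real_complex.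
rewrite (_ : series _ = fun n => polar (S^~ n)).
  have n1 : `|1| = 1 :> R[i] by rewrite normr1.
  have nN1 : `|-1| = 1 :> R[i] by rewrite normrN1.
  have ni : `|'i| = 1 :> R[i] by rewrite normCi.
  have nNi : `|- 'i| = 1 :> R[i] by rewrite normrN normCi.
  have cB a b : `|a| = 1 -> `|b| = 1 ->
      ((S a n)%:C - (S b n)%:C : R[i]^o) @[n --> \oo] --> ((N a)%:C - (N b)%:C :
        R[i]^o).
    by move=> a1 b1; exact: (@cvgB _ R[i]^o _ _ _ _ _ _ _ (SN a a1) (SN b b1)).
  apply: cvg_scalar_mul.
  exact: (@cvgD _ R[i]^o _ _ _ _ _ _ _ (cB _ _ n1 nN1) (cvg_scalar_mul (a := 'i)
    (cB _ _ ni nNi))).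
apply/funext => n; rewrite /series/= /polar.
rewrite -!raddfB/= -!sumrB !raddf_sum/= mulr_sumr -big_split/= mulr_sumr.
by apply: eq_bigr => i _; rewrite inner_polar /polar !raddfB.
Qed.

(** Serves to compare series of inner products indexed differently, or taken in different spaces,
    through their square sums alone. *)
Lemma polar_transfer (E F : hilbertType R) (u v : nat -> E) (u' v' : nat -> F) :
  (sqsum u < +oo)%E -> (sqsum v < +oo)%E ->
  (forall c, `|c| = 1 -> sqsum (fun n => v n + c *: u n) =
                         sqsum (fun n => v' n + c *: u' n)) ->
  exists t, series (fun n => inner (u n) (v n) : R[i]^o) @ \oo --> (t : R[i]^o) /\
            series (fun n => inner (u' n) (v' n) : R[i]^o) @ \oo --> (t : R[i]^o).
Proof.
move=> u_fin v_fin uv.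
have fin c : sqsum (fun n => v n + c *: u n) =
    (fine (sqsum (fun n => v n + c *: u n)))%:E.
  by rewrite fineK// ge0_fin_numE ?sqsum_ge0// sqsumD_lty.
eexists; split; first by apply: polar_series => c _; exact: fin.
by apply: polar_series => c c1; rewrite -uv.
Qed.

Lemma inner_series (E F : hilbertType R) (x y : E) (u v : nat -> F) :
  (forall c, `|c| = 1 -> sqsum (fun n => v n + c *: u n) = (nsq (y + c *: x))%:E) ->
  series (fun n => inner (u n) (v n) : R[i]^o) @ \oo --> (inner x y : R[i]^o).
Proof. by move=> /polar_series; rewrite inner_polar. Qed.

(** Tonelli's theorem along an enumeration of pairs; it turns doubly indexed families into
    sequences. *)
Lemma nat_pairing : exists2 p : nat -> nat * nat, injective p &
  (forall n m, exists k, p k = (n, m)) /\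
  forall (V : normedZmodType R[i]) (x : nat -> nat -> V),
    sqsum (fun k => x (p k).1 (p k).2) = (\sum_(0 <= n <oo) sqsum (x n))%E.
Proof.
have /card_set_bijP[p pbij] : ([set: nat] #= [set: nat * nat])%card.
  by rewrite card_eq_sym; exact: card_nat2.
exists p; first by move=> k l; apply: (set_bij_inj pbij); rewrite inE.
split=> [n m|V x].
  by have [k _ kE] := @set_bij_surj _ _ _ _ _ pbij (n, m) Logic.I; exists k.
have x0 n m : (0 <= (nsq (x n m))%:E)%E by rewrite lee_fin nsq_ge0.
rewrite /sqsum nneseries_esumT//.
rewrite -(@reindex_esum _ _ _ _ _ p (fun k => (nsq (x k.1 k.2))%:E) pbij).
rewrite nneseries_esumT => [|n]; last exact: sqsum_ge0.
rewrite (eq_esum (fun n _ => nneseries_esumT (x0 n))) esum_esum//.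
by congr (esum _ _); apply/seteqP.
Qed.

End Polarization.

(** * Hilbert-Schmidt operators and the trace *)

Section HilbertSchmidt.
Context (R : realType).
Implicit Types E F : hilbertType R.

Lemma onb_orthosystem E (e : nat -> E) : orthonormal_basis e -> orthosystem e.
Proof.
move=> [ee _]; split=> [i j ij|i]; first by rewrite ee (negbTE ij).
by right; apply: (@complexI R); rewrite -inner_nsq ee eqxx.
Qed.

Lemma parseval_onb E (e : nat -> E) x : orthonormal_basis e ->
  sqsum (fun n => inner (e n) x) = (nsq x)%:E.
Proof. by move=> eb; apply: parseval (onb_orthosystem eb) eb.2. Qed.

(** By Parseval both sides are double sums of the squared matrix entries of [K], taken in the two
    orders. *)
Lemma sqsum_adjoint E F (K : 'B(E, F)) (f : nat -> E) (e : nat -> F) :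
  orthonormal_basis f -> orthonormal_basis e ->
  sqsum (fun n => adjoint K (e n)) = sqsum (fun p => K (f p)).
Proof.
move=> fb eb; rewrite /sqsum.
transitivity (\sum_(0 <= n <oo) \sum_(0 <= p <oo)
    (nsq (inner (f p) (adjoint K (e n))))%:E)%E.
  by apply: eq_eseriesr => n _; rewrite -(parseval_onb _ fb).
rewrite nneseries_interchange; last by move=> n p; rewrite lee_fin nsq_ge0.
apply: eq_eseriesr => p _; rewrite -(parseval_onb _ eb); apply: eq_eseriesr => n _.
by rewrite adjointE -inner_conj nsq_conj.
Qed.

(** Independence of the basis: [sqsum_adjoint] is applied twice, passing through the square sum of
    [adjoint A] over [e]. *)
Lemma hilbert_schmidt_sqsum E (A : 'B(E)) (f : nat -> E) :
  orthonormal_basis f -> hilbert_schmidt A -> (sqsum (fun n => A (f n)) < +oo)%E.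
Proof.
move=> fb [e [eb /sqsum_series_cvgP]].
by rewrite -(sqsum_adjoint A eb eb) (sqsum_adjoint A fb eb).
Qed.

Lemma sqsum_hilbert_schmidt E (A : 'B(E)) (f : nat -> E) :
  orthonormal_basis f -> (sqsum (fun n => A (f n)) < +oo)%E -> hilbert_schmidt A.
Proof. by move=> fb /sqsum_series_cvgP Af; exists f. Qed.

Lemma hilbert_schmidt_adjoint E (A : 'B(E)) :
  hilbert_schmidt A -> hilbert_schmidt (adjoint A).
Proof.
move=> hA; have [e [eb _]] := hA.
by apply: (sqsum_hilbert_schmidt eb);
  rewrite (sqsum_adjoint A eb eb) hilbert_schmidt_sqsum.
Qed.

(** The trace is computed in an arbitrary basis [e], while the second series involves only [f];
    their agreement gives existence of the trace and its independence of the basis. *)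
Lemma trace_formula E (A B S : 'B(E)) (f : nat -> E) : orthonormal_basis f ->
  hilbert_schmidt A -> hilbert_schmidt B ->
  exists t, has_trace (A \ob B \ob S) t /\
    series (fun p => inner (adjoint B (f p)) (S (A (f p))) : R[i]^o) @ \oo --> (t
      : R[i]^o).
Proof.
move=> fb hA hB.
pose w p := adjoint S (adjoint B (f p)).
have w_fin : (sqsum w < +oo)%E.
  have [C C0 bnd] := bop_bound (adjoint S).
  apply: (sqsum_le_lty (ltW C0) (fun p => bnd _)).
  exact: hilbert_schmidt_sqsum (hilbert_schmidt_adjoint hB).
have A_fin := hilbert_schmidt_sqsum fb hA.
pose N c := fine (sqsum (fun p => A (f p) + c *: w p)).
have NE c : sqsum (fun p => A (f p) + c *: w p) = (N c)%:E.
  by rewrite /N fineK// ge0_fin_numE ?sqsum_ge0// sqsumD_lty.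
exists (polar N); split; last first.
  rewrite (_ : (fun p => _) = (fun p => inner (w p) (A (f p)))); last first.
    by apply/funext => p; rewrite /w [RHS]adjointEl.
  by apply: polar_series => c _; exact: NE.
move=> e eb.
rewrite (_ : (fun n => _) =
    (fun n => inner (adjoint A (e n)) (B (S (e n))))); last first.
  by apply/funext => n; rewrite [RHS]adjointEl.
apply: polar_series => c c1; rewrite -NE.
(* [K] is chosen so that its square sum over [e] is the one polarizing the trace series. As [c] has
   modulus 1, [adjoint K (f p)] is [c^*] times [A (f p) + c *: w p], whose square sum is [N c]. *)
pose K : 'B(E) := B \ob S + c *: adjoint A.
have KE x : K x = B (S x) + c *: adjoint A x by [].
have aKE y : adjoint K y = c^* *: (A y + c *: adjoint S (adjoint B y)).
  apply: inner_ext => z; rewrite adjointE KE innerDl innerZl scalerDr scalerA.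
  rewrite [c^* * c]mulrC -normCK c1 expr1n scale1r innerDr innerZr !adjointE
    adjointEl.
  by rewrite addrC.
rewrite -(@eq_sqsum _ _ _ (fun n => K (e n)))// -(sqsum_adjoint K eb fb).
apply: eq_sqsum => p; rewrite aKE nsqZ nsq_conj (_ : nsq c = 1) ?mul1r//.
by apply: (@complexI R); rewrite nsqE c1 expr1n.
Qed.

Lemma has_trace_unique E (rho : 'B(E)) (e : nat -> E) s t :
  orthonormal_basis e -> has_trace rho s -> has_trace rho t -> s = t.
Proof. by move=> eb /(_ e eb) hs /(_ e eb) ht; apply: (cvg_unique _ hs ht). Qed.

Lemma has_traceE E (rho : 'B(E)) (e : nat -> E) t :
  orthonormal_basis e -> has_trace rho t -> trace rho = t.
Proof.
move=> eb ht; rewrite /trace; case: xgetP => [s _ hs|no].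
  exact: has_trace_unique eb hs ht.
by have /no := ht.
Qed.

(** Each diagonal entry is the inner product of the components of [y] and [x] along [e n], so the
    series polarizes to Parseval sums. *)
Lemma has_trace_ketbra E (x y : E) : has_trace (ketbra x y) (inner y x).
Proof.
move=> e eb.
rewrite (_ : (fun n => _) = (fun n =>
    inner (inner (e n) y *: e n) (inner (e n) x *: e n))); last first.
  apply/funext => n; rewrite innerZl innerZr eb.1 eqxx mulr1 inner_conj.
  by rewrite [ketbra x y _]/(inner y (e n) *: x) innerZr.
apply: inner_series => c _; rewrite -(parseval_onb _ eb); apply: eq_sqsum => n.
rewrite scalerA -scalerDl nsqZ innerDr innerZr.
case: ((onb_orthosystem eb).2 n) => [->|->]; last by rewrite mulr1.
by rewrite !inner0l mulr0 addr0 nsq0 mul0r.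
Qed.

Lemma hilbert_schmidt_ketbra E (x y : E) (e : nat -> E) :
  orthonormal_basis e -> hilbert_schmidt (ketbra x y).
Proof.
move=> eb; apply: (sqsum_hilbert_schmidt eb).
apply: (@sqsum_le_lty _ _ _ _ (fun n => inner (e n) y) (nsq x)) => [|n|].
- exact: nsq_ge0.
- by rewrite [ketbra x y _]/(inner y (e n) *: x) nsqZ mulrC -inner_conj nsq_conj.
- by rewrite (parseval_onb _ eb) ltry.
Qed.

Lemma trace_class_ketbra E (x y : E) (e : nat -> E) :
  orthonormal_basis e -> trace_class (ketbra x y).
Proof.
move=> eb; exists (ketbra x (e 0%N)), (ketbra (e 0%N) y).
split; try exact: (hilbert_schmidt_ketbra _ _ eb).
apply: bopext => h.
by rewrite /= innerZr eb.1 eqxx mulr1.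
Qed.

Lemma nsq_sum_le E (c : nat -> R[i]) (x : nat -> E) n :
  nsq (\sum_(i < n) c i *: x i) <= (\sum_(i < n) nsq (c i)) * (\sum_(i < n) nsq
    (x i)).
Proof.
elim: n => [|n IH]; first by rewrite !big_ord0 nsq0 mulr0.
rewrite !big_ord_recr/=; set a := \sum_(i < n) _ in IH *.
set P := \sum_(i < n) _ in IH *; set Q := \sum_(i < n) _ in IH *.
have P0 : 0 <= P by apply: sumr_ge0 => i _; exact: nsq_ge0.
have Q0 : 0 <= Q by apply: sumr_ge0 => i _; exact: nsq_ge0.
have := sqrt_nsqD a (c n *: x n); rewrite nsqZ.
have := sqr_sqrtr (nsq_ge0 a).
have := sqr_sqrtr (nsq_ge0 (a + c n *: x n)).
have := sqr_sqrtr (mulr_ge0 (nsq_ge0 (c n)) (nsq_ge0 (x n))).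
have := nsq_ge0 (c n); have := nsq_ge0 (x n).
have := sqrtr_ge0 (nsq a); have := sqrtr_ge0 (nsq (c n) * nsq (x n)).
have := sqrtr_ge0 (nsq (a + c n *: x n)).
move: IH; set s := Num.sqrt (nsq a); set r := Num.sqrt (nsq (a + _)).
set t := Num.sqrt (_ * _).
move: (nsq a) (nsq (a + _)) (nsq (c n)) (nsq (x n)) => A B p q.
move: s r t => s r t APQ r0 t0 s0 q0 p0 t2 r2 s2 rst.
(* From [s ^+ 2 <= P * Q] and [t ^+ 2 = p * q], the arithmetic-geometric mean inequality bounds the
   cross term in [(P + p) * (Q + q)]. *)
have st : (2 * (s * t)) ^+ 2 <= (P * q + p * Q) ^+ 2.
  have -> : (2 * (s * t)) ^+ 2 = 4 * (A * (p * q)) by rewrite -s2 -t2; ring.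
  have := ler_wpM2r (mulr_ge0 p0 q0) APQ; have := sqr_ge0 (P * q - p * Q); nra.
have {}st : 2 * (s * t) <= P * q + p * Q.
  by rewrite -(@ler_pXn2r _ 2)// nnegrE ?addr_ge0 ?mulr_ge0.
have : r ^+ 2 <= (s + t) ^+ 2 by rewrite ler_pXn2r// nnegrE addr_ge0.
nra.
Qed.

Lemma hilbert_schmidt_onb E (f x : nat -> E) : orthonormal_basis f ->
  (sqsum x < +oo)%E -> exists2 A : 'B(E), hilbert_schmidt A & forall n, A (f n) =
    x n.
Proof.
move=> fb x_fin; have of_ := onb_orthosystem fb.
(* [h] is a finite combination of the basis, with its Fourier coefficients, so Pythagoras bounds
   their square sum. Asking for all large [M] makes [G] linear: two ranks are merged by [maxn]. *)
pose G h y := exists N, forall M, (N <= M)%N ->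
  h = fourier_sum f M h /\ y = \sum_(n < M) inner (f n) h *: x n.
have fourier_onb p M : (p < M)%N ->
    forall (y : nat -> E), \sum_(n < M) inner (f n) (f p) *: y n = y p.
  move=> pM y; rewrite (bigD1 (Ordinal pM))//= big1 => [|n np].
    by rewrite addr0 fb.1 eqxx scale1r.
  by rewrite fb.1 (_ : (n == p :> nat) = false) ?scale0r//; apply: negbTE.
have Glin (a : R[i]) u v u' v' : G u v -> G u' v' -> G (a *: u + u') (a *: v + v').
  move=> [N hN] [N' hN']; exists (maxn N N') => M; rewrite geq_max.
  move=> /andP[/hN[uE vE] /hN'[uE' vE']]; split.
    by rewrite fourier_sum_linear -uE -uE'.
  rewrite {1}vE {1}vE' scaler_sumr -big_split/=; apply: eq_bigr => n _.
  by rewrite innerDr innerZr scalerDl scalerA.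
have GE p : G (f p) (x p).
  by exists p.+1 => M pM; rewrite /fourier_sum !fourier_onb.
have [r xr] := (sqsum_ltyP x).1 x_fin.
have [h y [N /(_ N (leqnn N))[hE ->]]|h e e0|A AG] := relation_extension (C := r)
  Glin.
- rewrite (le_trans (nsq_sum_le (fun n => inner (f n) h) x N))// mulrC.
  rewrite ler_pM//.
  + by apply: sumr_ge0 => i _; exact: nsq_ge0.
  + by apply: sumr_ge0 => i _; exact: nsq_ge0.
  + rewrite -lee_fin -xr -sumEFin -(big_mkord xpredT (fun n => (nsq (x n))%:E)).
    by apply: nneseries_lim_ge => n *; rewrite lee_fin nsq_ge0.
  + by rewrite (fourier_sum_pythagoras of_ N h) lerDl nsq_ge0.
- have /closure_nsqP/(_ e e0)[h' fh' hh'] : closure (lin_span (range f)) h by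
  rewrite fb.2.
  have [y Gy] : [set u | exists y, G u y] h'; last by exists h', y.
  apply: lin_span_min fh' => [_ [p _ <-]||a u v [y Gy] [z Gz]];
    first by exists (x p).
  + by exists 0, 0%N => M _; rewrite /fourier_sum !big1// => n _;
    rewrite inner0r scale0r.
  + by exists (a *: y + z); exact: Glin.
exists A; last by move=> n; apply: AG.
apply: (sqsum_hilbert_schmidt fb).
by rewrite (@eq_sqsum _ _ _ _ x)// => n; rewrite (AG _ (x n)).
Qed.

(** [rho] is the sum of the [ketbra (x n) (y n)], obtained as [A \ob adjoint B] where [A] and [B]
    send [f n] to [x n] and [y n]. *)
Lemma trace_class_series E (f x y : nat -> E) : orthonormal_basis f ->
  (sqsum x < +oo)%E -> (sqsum y < +oo)%E ->
  exists2 rho : 'B(E), trace_class rho &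
    forall S, exists t, has_trace (rho \ob S) t /\
      series (fun n => inner (y n) (S (x n)) : R[i]^o) @ \oo --> (t : R[i]^o).
Proof.
move=> fb /(hilbert_schmidt_onb fb)[A hA Af] /(hilbert_schmidt_onb fb)[B hB Bf].
have hB' := hilbert_schmidt_adjoint hB.
exists (A \ob adjoint B); first by exists A, (adjoint B).
move=> S; have [t [ht st]] := trace_formula S fb hA hB'.
exists t; split=> //; rewrite (_ : (fun n => _) =
  (fun p => inner (adjoint (adjoint B) (f p)) (S (A (f p)))))//.
by apply/funext => n; rewrite adjointEl adjointE Bf Af.
Qed.

End HilbertSchmidt.

(** * The Hardy space *)

Section Hardy.
Context (R : realType).

Lemma cvg_series_geometric (q : R[i]) : `|q| < 1 ->
  series (fun n => q ^+ n : R[i]^o) @ \oo --> ((1 - q)^-1 : R[i]^o).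
Proof.
move=> q1; have q_neq1 : 1 - q != 0.
  by rewrite subr_eq0; apply: contraTneq q1 => <-; rewrite normr1 ltxx.
have nq1 : nsq q < 1.
  by rewrite -ltcR nsqE rmorph1 expr_lt1.
apply/cvg_nsqP => e e0.
have E n : series (fun n => q ^+ n : R[i]^o) n - (1 - q)^-1 = - (1 - q)^-1 * q ^+ n.
  have -> : series (fun n => q ^+ n : R[i]^o) n = (1 - q)^-1 * (1 - q ^+ n).
    apply: (mulfI q_neq1); rewrite mulVKf// -{2}(expr1n _ n) subrXX.
    rewrite /series/= big_mkord; congr (_ * _); apply: eq_bigr => i _.
    by rewrite expr1n mul1r.
  by rewrite mulrBr mulr1 addrAC subrr sub0r mulNr.
have nn0 : 0 < nsq (- (1 - q)^-1) by rewrite lt_def nsq_ge0 nsq_eq0 oppr_eq0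
  invr_eq0 q_neq1.
have /cvgrPdist_lt/(_ (e / nsq (- (1 - q)^-1))) : (nsq q ^+ n) @[n --> \oo] -->
  (0 : R).
  by apply: cvg_expr; rewrite ger0_norm ?nsq_ge0.
rewrite divr_gt0// => /(_ isT); apply: filterS => n.
rewrite sub0r normrN ger0_norm ?exprn_ge0 ?nsq_ge0// ltr_pdivlMr// E nsqM mulrC.
by rewrite (_ : nsq (q ^+ n) = nsq q ^+ n)//; apply: (@complexI R);
  rewrite nsqE rmorphXn/= nsqE normrX exprAC.
Qed.

Lemma cvg_series_delta (b : nat -> R[i]) n :
  series (fun k => (k == n)%:R * b k : R[i]^o) @ \oo --> (b n : R[i]^o).
Proof.
apply/cvg_nsqP => e e0; exists n.+1 => // N /= nN.
rewrite /series/= big_mkord (bigD1 (Ordinal nN))//= big1 => [|k kn].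
  by rewrite eqxx mul1r addr0 subrr nsq0.
by rewrite (_ : (k == n :> nat) = false) ?mul0r//; apply: negbTE.
Qed.

Context (H2 : hardySpace R).

Lemma hardy_taylor (u : H2) : exists a, taylor (fs_ev H2 u) a.
Proof.
by have [a [ta _]] := (hardy_mem H2 (fs_ev H2 u)).1 (ex_intro _ u erefl); exists a.
Qed.

Lemma szego_taylor (w : disk R) :
  taylor (fun z => szego z w) (fun n => (w : R[i])^* ^+ n).
Proof.
move=> z; rewrite /szego (_ : (fun n => _) = (fun n => ((z : R[i]) * (w :
  R[i])^*) ^+ n)).
  apply: cvg_series_geometric; rewrite normrM norm_conjC.
  by rewrite mulr_ilt1// diskP.
by apply/funext => n; rewrite exprMn mulrC.
Qed.

Lemma hardy_kernelE (w z : disk R) : fs_ev H2 (hardy_kernel H2 w) z = szego z w.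
Proof.
rewrite /hardy_kernel; case: xgetP => [u _ uE//|no].
have [|u uE] := (hardy_mem H2 (fun z => szego z w)).2.
  exists (fun n => (w : R[i])^* ^+ n); split; first exact: szego_taylor.
  apply/sqsum_series_cvgP/sqsum_ltyP; exists (1 - nsq (w : R[i]))^-1.
  have w1 : nsq (w : R[i]) < 1 by rewrite -ltcR nsqE rmorph1 expr_lt1// diskP.
  apply/sqsum_cvgP;
    have : series (geometric 1 (nsq (w : R[i]))) @ \oo --> 1 * (1 - nsq (w :
      R[i]))^-1.
    by apply: cvg_geometric_series; rewrite ger0_norm ?nsq_ge0.
  rewrite mul1r; apply: cvg_trans; apply: near_eq_cvg; apply: nearW => n.
  apply: eq_bigr => i _; rewrite /geometric/= mul1r.
  by apply: (@complexI R); rewrite nsqE rmorphXn/= nsqE normrX norm_conjC exprAC.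
by exfalso; apply: (no u) => z'; rewrite uE.
Qed.

(** The Taylor coefficients of the kernel are the powers of the conjugate of [w], so the inner
    product of coefficient sequences is the power series of [u] at [w]. *)
Lemma hardy_reproducing (w : disk R) (u : H2) :
  inner (hardy_kernel H2 w) u = fs_ev H2 u w.
Proof.
have [a ua] := hardy_taylor u.
have kw : taylor (fs_ev H2 (hardy_kernel H2 w)) (fun n => (w : R[i])^* ^+ n).
  by move=> z; rewrite hardy_kernelE; exact: szego_taylor.
apply: (cvg_unique _ (hardy_inner kw ua)) => //.
rewrite (_ : (fun n => _) = (fun n => a n * (w : R[i]) ^+ n)); first exact: ua.
by apply/funext => n; rewrite rmorphXn/= conjCK mulrC.
Qed.

Lemma hardy_ext (u v : H2) :
  (forall w, inner (hardy_kernel H2 w) u = inner (hardy_kernel H2 w) v) -> u = v.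
Proof.
move=> uv; apply: fs_ev_inj; apply/funext => w; rewrite -!hardy_reproducing.
exact: uv.
Qed.

Lemma hardy_kernel_total : total_set (range (hardy_kernel H2)).
Proof.
apply: orthogonal_total => u u0; apply: hardy_ext => w.
by rewrite inner0r u0//; exists w.
Qed.

(** The basis consists of the monomials; pairing with the [n]-th one extracts the [n]-th Taylor
    coefficient, which gives totality. *)
Lemma hardy_onb : exists e : nat -> H2, orthonormal_basis e.
Proof.
have taylorX n : taylor (fun z : disk R => (z : R[i]) ^+ n) (fun k => (k == n)%:R).
  by move=> z; exact: cvg_series_delta.
have /boolp.choice[e eE] : forall n, exists u, fs_ev H2 u = (fun z : disk R => (z
  : R[i]) ^+ n).
  move=> n; apply/(hardy_mem H2); exists (fun k => (k == n)%:R); split=> //.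
  apply/cvg_ex; exists (1 : R[i]^o).
  rewrite (_ : (fun k => _) = (fun k => (k == n)%:R * 1));
    first exact: cvg_series_delta.
  by apply/funext => k; case: eqP;
    rewrite ?normr1 ?normr0 ?expr1n ?expr0n ?mul1r ?mul0r.
have etaylor n : taylor (fs_ev H2 (e n)) (fun k => (k == n)%:R) by rewrite eE.
have inner_e n u a : taylor (fs_ev H2 u) a -> inner (e n) u = a n.
  move=> ua; apply: (cvg_unique _ (hardy_inner (etaylor n) ua)) => //.
  rewrite (_ : (fun k => _) = (fun k => (k == n)%:R * a k));
    first exact: cvg_series_delta.
  by apply/funext => k; rewrite conjC_nat.
exists e; split=> [i j|]; first by rewrite (inner_e _ _ _ (etaylor j)) eq_sym.
apply: orthogonal_total => u u0; have [a ua] := hardy_taylor u.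
have a0 n : a n = 0 by rewrite -(inner_e n _ _ ua) u0//; exists n.
apply: fs_ev_inj; apply/funext => z; rewrite raddf0.
apply: (cvg_unique _ (ua z)) => //.
rewrite (_ : (fun n => _) = (fun n => 0)).
  rewrite (_ : series _ = fun=> 0); first exact: cvg_cst.
  by apply/funext => n; rewrite /series/= big1.
by apply/funext => n; rewrite a0 mul0r.
Qed.

End Hardy.

(** * Ampliations *)

Section Tensor.
Context (R : realType).

Lemma inner_total_ext (E : hilbertType R) (A : set E) (x y : E) : total_set A ->
  (forall a, A a -> inner a x = inner a y) -> x = y.
Proof.
move=> tA Axy; apply/eqP; rewrite -subr_eq0 -nsq_eq0; apply/eqP/(@complexI R).
rewrite -inner_nsq; move: {2}(x - y); apply: (total_ind tA).
- by move=> a Aa /=; rewrite -inner_conj innerBr Axy// subrr conjC0.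
- exact: inner0r.
- by move=> c u v /= u0 v0; rewrite innerDr innerZr u0 v0 mulr0 addr0.
- exact: closed_inner0.
Qed.

Lemma bop_closure_span (E F : hilbertType R) (A : 'B(E, F)) (S : set E) (B : set
  F) :
  total_set S -> (forall x, S x -> closure (lin_span B) (A x)) ->
  forall x, closure (lin_span B) (A x).
Proof.
move=> tS SB; apply: (@total_ind _ _ _ (A @^-1` closure (lin_span B)) tS) => //.
- by rewrite /= linear0; exact: closure_lin_span0.
- by move=> a x y /= hx hy; rewrite bop_linear; exact: closure_lin_spanP.
- apply: preimage_closed; last exact: closed_closure.
  by move=> x _; exact: bop_continuous.
Qed.

Context (E F : hilbertType R) (T : hilbertTensor E F).

Lemma nsq_tensor x y : nsq (tensor T x y) = nsq x * nsq y.
Proof.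
by apply: (@complexI R); rewrite rmorphM/= -!inner_nsq inner_tensor.
Qed.

Lemma tensorr_subproof (y : F) : (fun x => tensor T x y) \in @bounded_op R E T.
Proof.
have [A AE] : exists A : 'B(E, T), forall x, A x = tensor T x y.
  apply: (bop_of_bound (C := nsq y)) => [a x x'|x]; first exact: linearPl.
  by rewrite nsq_tensor mulrC.
by rewrite (_ : (fun x => _) = A); [exact: bopP|apply/funext].
Qed.
Definition tensorr y : 'B(E, T) := Bop (tensorr_subproof y).

Lemma tensorl_subproof (x : E) : tensor T x \in @bounded_op R F T.
Proof.
have [A AE] : exists A : 'B(F, T), forall y, A y = tensor T x y.
  apply: (bop_of_bound (C := nsq x)) => [a y y'|y]; first exact: linearPr.
  by rewrite nsq_tensor.
by rewrite (_ : (tensor T x : F -> T) = A); [exact: bopP|apply/funext].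
Qed.
Definition tensorl x : 'B(F, T) := Bop (tensorl_subproof x).

(** One factor is approximated at a time, using continuity of [tensorr y] and then of
    [tensorl x]. *)
Lemma tensor_total_set (A : set E) (B : set F) : total_set A -> total_set B ->
  total_set [set t : T | exists x y, [/\ A x, B y & t = tensor T x y]].
Proof.
move=> tA tB; apply: total_subclosure (tensor_total T) _ => _ [x [y ->]].
apply: (@bop_closure_span _ _ (tensorr y) _ _ tA) => {}x Ax.
apply: (@bop_closure_span _ _ (tensorl x) _ _ tB) => {}y By.
by apply/subset_closure/lin_span_sub; exists x, y.
Qed.

Lemma adjoint_tensorr (x : E) (y z : F) :
  adjoint (tensorr z) (tensor T x y) = inner z y *: x.
Proof. by apply: inner_ext => u; rewrite adjointE inner_tensor innerZr mulrC. Qed.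

Context (e : nat -> E) (g : nat -> F).
Hypotheses (eb : orthonormal_basis e) (og : orthosystem g) (tg : total_set (range
  g)).

(** The tensors of [e n] with [g a] form a total orthosystem of [T]; Parseval for it, grouped by
    [a], leaves Parseval in [E] for each slice. *)
Lemma sqsum_slices (t : T) :
  sqsum (fun a => adjoint (tensorr (g a)) t) = (nsq t)%:E.
Proof.
have [p pinj [psurj psum]] := nat_pairing R.
pose h k := tensor T (e (p k).2) (g (p k).1).
have oe := onb_orthosystem eb.
have oh : orthosystem h.
  split=> [i j ij|i].
    rewrite /h inner_tensor; have [e2|/oe.1 ->] := eqVneq (p i).2 (p j).2;
      last by rewrite mul0r.
    have [e1|/og.1 ->] := eqVneq (p i).1 (p j).1; last by rewrite mulr0.
    by move/eqP : ij; case; apply: pinj;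
      case: (p i) (p j) e1 e2 => ? ? [? ?] /= -> ->.
  rewrite /h nsq_tensor; case: (oe.2 (p i).2) => [->|->]; first by left;
    rewrite linear0l.
  by case: (og.2 (p i).1) => [->|->]; [left; rewrite linear0r|right; rewrite mulr1].
have th : total_set (range h).
  apply: total_subclosure (tensor_total_set eb.2 tg) _ => _ [_ [_ [[n _ <-] [a _
    <-] ->]]].
  by have [k pk] := psurj a n; apply/subset_closure/lin_span_sub; exists k;
    rewrite // /h pk.
rewrite -(parseval t oh th).
transitivity (\sum_(0 <= a <oo)
    sqsum (fun n => inner (e n) (adjoint (tensorr (g a)) t)))%E.
  by apply: eq_eseriesr => a _; rewrite parseval_onb.
by rewrite -psum; apply: eq_sqsum => k; rewrite adjointE.
Qed.

Lemma slices_series (s t : T) :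
  series (fun a => inner (adjoint (tensorr (g a)) s) (adjoint (tensorr (g a)) t)
    : R[i]^o)
    @ \oo --> (inner s t : R[i]^o).
Proof.
apply: inner_series => c _; rewrite -sqsum_slices; apply: eq_sqsum => a.
by rewrite bopD bopZ.
Qed.

(** Existence needs a bound on combinations of elementary tensors. The slices of the image are [S]
    applied to the slices of the original, so summing over slices preserves the bound of [S]. *)
Lemma ampliation_tensor (S : 'B(E)) x y :
  ampliation T S (tensor T x y) = tensor T (S x) y.
Proof.
rewrite /ampliation; case: xgetP => [A _ //|no].
have [C C0 bnd] := bop_bound S.
have [||A AE] := @bop_extension R T T (E * F)%type
  (fun p => tensor T p.1 p.2) (fun p => tensor T (S p.1) p.2) C.
- rewrite [X in total_set X](_ : _ = [set t | exists x y, t = tensor T x y]);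
  first exact: tensor_total.
  by apply/seteqP; split=> [_ [p _ <-]|_ [u [v ->]]];
    [exists p.1, p.2|exists (u, v)].
- move=> n c i; set t' := \sum_j _; set t := \sum_j _.
  rewrite -lee_fin -sqsum_slices EFinM -sqsum_slices;
    apply: sqsum_le (ltW C0) _ => a.
  rewrite (_ : adjoint _ t' = S (adjoint (tensorr (g a)) t)) ?bnd//.
  rewrite /t /t' !bop_sum; apply: eq_bigr => j _.
  by rewrite !bopZ !adjoint_tensorr !bopZ.
by case: (no A) => u v; exact: (AE (u, v)).
Qed.

Lemma tensor_bopext (G : hilbertType R) (A B : 'B(T, G)) :
  (forall x y, A (tensor T x y) = B (tensor T x y)) -> A = B.
Proof.
by move=> AB; apply: total_bopext (tensor_total T) _ => _ [x [y ->]]; exact: AB.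
Qed.

Lemma ampliation_linear : linear (ampliation T : 'B(E) -> 'B(T)).
Proof.
move=> a S S'; apply: tensor_bopext => x y.
rewrite [RHS](_ : _ = a *: ampliation T S (tensor T x y) + ampliation T S'
  (tensor T x y))//.
by rewrite !ampliation_tensor linearPl.
Qed.

Lemma ampliation_id : ampliation T (id_bop E) = id_bop T.
Proof. by apply: tensor_bopext => x y; rewrite ampliation_tensor. Qed.

Lemma ampliation_adjoint (S : 'B(E)) x y t :
  inner (tensor T x y) (ampliation T S t) = inner (tensor T (adjoint S x) y) t.
Proof.
rewrite -adjointEl; congr (inner _ t).
apply: inner_total_ext (tensor_total T) _ => _ [u [v ->]].
by rewrite adjointE ampliation_tensor !inner_tensor adjointE.
Qed.

Lemma slice_ampliation (S : 'B(E)) y t :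
  adjoint (tensorr y) (ampliation T S t) = S (adjoint (tensorr y) t).
Proof.
apply: inner_ext => x; rewrite adjointE ampliation_adjoint.
by rewrite -adjointEl adjointE.
Qed.

End Tensor.

(** * The isometry and its Stinespring map *)

Section DeBrangesRovnyak.
Context (R : realType).

Lemma nsq_sum_gram (E F : hilbertType R) n (c : 'I_n -> R[i]) (u : 'I_n -> E) (v
  : 'I_n -> F) :
  (forall i j, inner (u i) (u j) = inner (v i) (v j)) ->
  nsq (\sum_i c i *: u i) = nsq (\sum_i c i *: v i).
Proof.
move=> uv; apply: (@complexI R); rewrite -!inner_nsq !inner_suml.
apply: eq_bigr => i _; rewrite !inner_sumr; apply: eq_bigr => j _.
by rewrite !innerZl !innerZr uv.
Qed.

Lemma closed_ge0_complex : closed [set z : R[i]^o | 0 <= z].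
Proof.
move=> z /closure_nsqP zc /=.
have nsqRI (x : R[i]) : nsq x = complex.Re x ^+ 2 + complex.Im x ^+ 2.
  by apply: (@complexI R); rewrite nsqE add_Re2_Im2.
rewrite lecE/=; apply/andP; split.
  rewrite -sqrf_eq0 eq_le sqr_ge0 andbT; apply/ler_addgt0Pr => e /zc[x /= x0].
  rewrite nsqRI add0r => h; move: x0; rewrite lecE/= => /andP[/eqP x0 _].
  move: h; rewrite raddfB/= raddfB/= x0 subr0;
    have := sqr_ge0 (complex.Re z - complex.Re x).
  lra.
rewrite leNgt; apply/negP => z0.
(* If [complex.Re z] were negative, every point with nonnegative real part would be at distance at
   least its absolute value from [z]. *)
have [|x /= x0] := zc (complex.Re z ^+ 2);
  first by rewrite exprn_even_gt0//= lt_eqF.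
rewrite nsqRI raddfB/= raddfB/=; move: x0; rewrite lecE/= => /andP[_ x0].
have := sqr_ge0 (complex.Im z - complex.Im x); nra.
Qed.

Lemma disk_szego_neq0 (z w : disk R) : 1 - (z : R[i]) * (w : R[i])^* != 0.
Proof.
rewrite subr_eq0; apply/eqP => h.
have := mulr_ilt1 (normr_ge0 (z : R[i])) (normr_ge0 (w : R[i])) (diskP z) (diskP w).
by rewrite -[X in _ * X]norm_conjC -normrM -h normr1 ltxx.
Qed.

Context (f : disk R -> disk R) (H2 : hardySpace R) (Hf : rkhs (dbr_kernel f)).
Local Notation k := (hardy_kernel H2).
Local Notation c := (rkhs_kernel Hf).

Lemma inner_hardy_kernel z w : inner (k z) (k w) = szego z w.
Proof. by rewrite hardy_reproducing hardy_kernelE. Qed.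

Lemma inner_dbr_kernel z w : inner (c z) (c w) = dbr_kernel f z w.
Proof. by rewrite -rkhs_reproducing rkhs_kernelE. Qed.

Lemma dbr_kernel_total : total_set (range c).
Proof.
apply: orthogonal_total => u u0; apply: fs_ev_inj; apply/funext => w.
by rewrite rkhs_reproducing u0 ?raddf0//; exists w.
Qed.

(* [k_w - c_w] has the positive definite kernel [f(z) k(z, w) f(w)^*], so that
   [k_w |-> c_w] extends to a contraction. *)
Lemma hardy_dbr_contraction : exists L : 'B(H2, Hf), forall w, L (k w) = c w.
Proof.
apply: (@bop_extension _ _ _ _ k c 1); first exact: hardy_kernel_total.
move=> n a w; rewrite mul1r -subr_ge0.
suff -> : nsq (\sum_j a j *: k (w j)) - nsq (\sum_j a j *: c (w j)) =
    nsq (\sum_j a j *: ((f (w j) : R[i])^* *: k (w j))) by exact: nsq_ge0.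
apply: (@complexI R); rewrite rmorphB/= -!inner_nsq !inner_suml -sumrB.
apply: eq_bigr => i _; rewrite !inner_sumr -sumrB; apply: eq_bigr => j _.
rewrite !innerZl !innerZr inner_hardy_kernel inner_dbr_kernel conjCK.
by rewrite /szego /dbr_kernel; field; exact: disk_szego_neq0.
Qed.

Lemma dbr_orthosystem : exists2 g : nat -> Hf, orthosystem g & total_set (range g).
Proof.
have [L LE] := hardy_dbr_contraction; have [e eb] := hardy_onb H2.
have [g og gL] := gram_schmidt (L \o e); exists g => //.
apply: total_subclosure dbr_kernel_total _ => _ [w _ <-]; rewrite -LE.
apply: (@bop_closure_span _ _ _ L _ _ eb.2) => _ [n _ <-].
exact/subset_closure/gL.
Qed.

Context (T : hilbertTensor H2 Hf).

Lemma inner_kernel_tensor z w :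
  inner (tensor T (k (f z)) (c z)) (tensor T (k (f w)) (c w)) = szego z w.
Proof.
rewrite inner_tensor inner_hardy_kernel inner_dbr_kernel /szego /dbr_kernel.
by field; rewrite !disk_szego_neq0.
Qed.

Lemma kernel_isometry_exists : exists V : 'B(H2, T),
  forall w, V (k w) = tensor T (k (f w)) (c w).
Proof.
apply: (@bop_extension _ _ _ _ k (fun w => tensor T (k (f w)) (c w)) 1).
  exact: hardy_kernel_total.
move=> n a w; rewrite mul1r le_eqVlt; apply/orP; left; apply/eqP.
apply: nsq_sum_gram => i j.
by rewrite inner_kernel_tensor inner_hardy_kernel.
Qed.

Variables (V : 'B(H2, T)).
Hypothesis VE : forall w, V (k w) = tensor T (k (f w)) (c w).
Local Notation Phi := (stinespring_map V).

Lemma kernel_isometry_adjointK h : adjoint V (V h) = h.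
Proof.
suff -> : adjoint V (V h) = (adjoint V \ob V) h.
  suff -> : adjoint V \ob V = id_bop H2 by [].
  apply: total_bopext (hardy_kernel_total H2) _ => _ [w _ <-].
  apply: hardy_ext => z.
  by rewrite /= adjointE !VE inner_kernel_tensor inner_hardy_kernel.
by [].
Qed.

Lemma inner_kernel_isometry h h' : inner (V h) (V h') = inner h h'.
Proof. by rewrite -adjointE kernel_isometry_adjointK. Qed.

Lemma nsq_kernel_isometry h : nsq (V h) = nsq h.
Proof. by apply: (@complexI R); rewrite -!inner_nsq inner_kernel_isometry. Qed.

Lemma inner_stinespring S h h' :
  inner h (Phi S h') = inner (V h) (ampliation T S (V h')).
Proof. by rewrite -adjointE. Qed.

End DeBrangesRovnyak.

Section Stinespring.
Context (R : realType) (f : disk R -> disk R).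
Context (H2 : hardySpace R) (Hf : rkhs (dbr_kernel f)) (T : hilbertTensor H2 Hf).
Local Notation k := (hardy_kernel H2).
Local Notation c := (rkhs_kernel Hf).

Variables (e : nat -> H2) (g : nat -> Hf) (V : 'B(H2, T)).
Hypotheses (eb : orthonormal_basis e) (og : orthosystem g).
Hypotheses (tg : total_set (range g)).
Hypothesis VE : forall w, V (k w) = tensor T (k (f w)) (c w).
Local Notation Phi := (stinespring_map V : 'B(H2) -> 'B(H2)).
Local Notation slice a := (adjoint (tensorr T (g a))).

Lemma stinespring_linear : linear Phi.
Proof.
move=> a S S'; apply: bopext => h.
rewrite [RHS](_ : _ = a *: adjoint V (ampliation T S (V h)) +
  adjoint V (ampliation T S' (V h)))//.
by rewrite /= (ampliation_linear T eb og tg) -bopZ -bopD.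
Qed.

Lemma stinespring_unital : Phi (id_bop H2) = id_bop H2.
Proof.
apply: bopext => h.
by rewrite /= (ampliation_id T eb og tg) /= (kernel_isometry_adjointK VE).
Qed.

Lemma stinespring_slices_series (S : 'B(H2)) h h' :
  series (fun a => inner (slice a (V h)) (S (slice a (V h'))) : R[i]^o) @ \oo -->
    (inner h (Phi S h') : R[i]^o).
Proof.
rewrite inner_stinespring.
have := @slices_series _ _ _ T _ _ eb og tg (V h) (ampliation T S (V h')).
rewrite (_ : (fun a => _) = (fun a => inner (slice a (V h)) (S (slice a (V
  h')))))//.
by apply/funext => a; rewrite (slice_ampliation eb og tg).
Qed.

(** For each [a], block positivity of [S] is tested on the slices of the [V (x i)]; finite sums over
    [a] are thus nonnegative, and so is their limit. *)
Lemma stinespring_completely_positive : completely_positive Phi.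
Proof.
move=> n S Spos x.
pose u (i j : 'I_n) N := series (fun a =>
  inner (slice a (V (x i))) (S i j (slice a (V (x j)))) : R[i]^o) N.
have ucvg : (\sum_i \sum_j u i j N : R[i]^o) @[N --> \oo] -->
    (\sum_i \sum_j inner (x i) (Phi (S i j) (x j)) : R[i]^o).
  apply: cvg_big => [|i _]; first exact: add_continuous.
  apply: cvg_big => [|j _]; first exact: add_continuous.
  exact: stinespring_slices_series.
apply: (@closed_cvg _ _ _ _ _ _ (@closed_ge0_complex R) _ _ ucvg).
apply: nearW => N /=; rewrite /u /series/=.
under eq_bigr do rewrite exchange_big/=.
rewrite exchange_big/=; apply: sumr_ge0 => a _.
exact: (Spos (fun i => slice a (V (x i)))).
Qed.

Lemma stinespring_minimal :
  total_set [set t : T | exists (S : 'B(H2)) (h : H2), t = ampliation T S (V h)].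
Proof.
apply: total_subclosure
  (tensor_total_set T (hardy_kernel_total H2) (dbr_kernel_total Hf)) _.
move=> _ [_ [_ [[w _ <-] [z _ <-] ->]]]; apply/subset_closure/lin_span_sub.
(* This rank-one operator sends [k (f z)] to [k w], so its ampliation maps [V (k z)] to the tensor
   of [k w] and [c z]. *)
exists (ketbra ((szego (f z) (f z))^-1 *: k w) (k (f z))), (k z).
rewrite VE (ampliation_tensor T eb og tg) /= inner_hardy_kernel scalerA divff
  ?scale1r//.
by rewrite invr_eq0 disk_szego_neq0.
Qed.

Lemma adjoint_multiplication h (M : 'B(H2)) w :
  is_multiplication h M -> adjoint M (k w) = (h w)^* *: k w.
Proof.
move=> hM; apply: inner_ext => u; rewrite adjointE innerZr -inner_conj.
by rewrite hardy_reproducing hM rmorphM/= -hardy_reproducing inner_conj.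
Qed.

(** Evaluation at [z] pairs with [V (k z)], whose first factor [k (f z)] is an eigenvector of
    [adjoint M]; the eigenvalue yields [h (f z)], and the isometry removes [V]. *)
Lemma stinespring_multiplication h (M : 'B(H2)) :
  is_multiplication h M -> is_multiplication (h \o f) (Phi M).
Proof.
move=> hM u z; rewrite -!hardy_reproducing inner_stinespring VE.
rewrite (ampliation_adjoint eb og tg) (adjoint_multiplication _ hM).
rewrite linearZl/= -VE innerZl conjCK inner_kernel_isometry//.
Qed.

Lemma sqsum_pair_slices (p : nat -> nat * nat) :
  (forall (W : normedZmodType R[i]) (x : nat -> nat -> W),
    sqsum (fun l => x (p l).1 (p l).2) = (\sum_(0 <= n <oo) sqsum (x n))%E) ->
  forall z : nat -> T, sqsum (fun l => slice (p l).2 (z (p l).1)) = sqsum z.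
Proof.
move=> psum z; rewrite (psum _ (fun n a => slice a (z n))).
by apply: eq_eseriesr => n _; rewrite (sqsum_slices eb og tg).
Qed.

(* The partial trace over [Hf] of [V rho V^*], for [rho = A B]: [A e_n] and
   [B^* e_n] are replaced by the slices of their images under [V]. *)
Lemma stinespring_preadjoint_trace rho : trace_class rho ->
  exists rho', trace_class rho' /\
    forall S, trace (rho' \ob S) = trace (rho \ob Phi S).
Proof.
move=> [A [B [hA hB ->]]]; have [p _ [_ psum]] := nat_pairing R.
have pslice := sqsum_pair_slices psum.
pose x n := V (A (e n)); pose y n := V (adjoint B (e n)).
have x_fin : (sqsum x < +oo)%E.
  rewrite (@eq_sqsum _ _ _ _ (fun n => A (e n)));
    first exact: hilbert_schmidt_sqsum.
  by move=> n; rewrite /x (nsq_kernel_isometry VE).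
have y_fin : (sqsum y < +oo)%E.
  rewrite (@eq_sqsum _ _ _ _ (fun n => adjoint B (e n))).
    exact: hilbert_schmidt_sqsum (hilbert_schmidt_adjoint hB).
  by move=> n; rewrite /y (nsq_kernel_isometry VE).
have x'_fin : (sqsum (fun l => slice (p l).2 (x (p l).1)) < +oo)%E by rewrite
  pslice.
have y'_fin : (sqsum (fun l => slice (p l).2 (y (p l).1)) < +oo)%E by rewrite
  pslice.
have [rho' trho' rho'E] := trace_class_series eb x'_fin y'_fin.
exists rho'; split=> // S.
have [t [ht st]] := trace_formula (Phi S) eb hA hB.
have [t' [ht' st']] := rho'E S.
rewrite (has_traceE eb ht) (has_traceE eb ht').
have Sx_fin : (sqsum (fun n => ampliation T S (x n)) < +oo)%E.
  have [C C0 bnd] := bop_bound (ampliation T S).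
  exact: (sqsum_le_lty (ltW C0) (fun n => bnd (x n))).
(* Passing to slices replaces each vector of [T] by countably many of [H2] with the same total
   square sum, so the series over [n] and the one over pairs polarize to the same value. *)
have slicesE b : `|b| = 1 -> sqsum (fun n => ampliation T S (x n) + b *: y n) =
    sqsum (fun l => S (slice (p l).2 (x (p l).1)) + b *: slice (p l).2 (y (p l).1)).
  move=> _; rewrite -pslice; apply: eq_sqsum => l.
  by rewrite bopD bopZ (slice_ampliation eb og tg).
have [s [us us']] := polar_transfer y_fin Sx_fin slicesE.
have yx n : inner (adjoint B (e n)) (Phi S (A (e n))) =
    inner (y n) (ampliation T S (x n)) by exact: inner_stinespring.
rewrite (funext yx) in st.
by rewrite (cvg_series_unique st us) (cvg_series_unique st' us').
Qed.

Lemma stinespring_normal : normal Phi.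
Proof.
move=> F S0 FF hF rho /stinespring_preadjoint_trace[rho' [/hF hrho' rho'E]].
rewrite -rho'E (_ : (fun S => _) = (fun S => trace (rho' \ob S)))//.
by apply/funext => S; rewrite rho'E.
Qed.

Lemma stinespring_preadjoint : exists Psi, is_preadjoint Phi Psi.
Proof.
have /boolp.choice[Psi PsiE] : forall rho, exists rho', trace_class rho ->
    trace_class rho' /\ forall S, trace (rho' \ob S) = trace (rho \ob Phi S).
  move=> rho; have [/stinespring_preadjoint_trace[rho' ?]|no] := pselect
    (trace_class rho).
    by exists rho'.
  (* An arbitrary value outside the trace class. *)
  by exists 0.
by exists Psi.
Qed.

Lemma trace_ketbra_comp (x y : H2) S : trace (ketbra x y \ob S) = inner y (S x).
Proof.
have -> : ketbra x y \ob S = ketbra x (adjoint S y).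
  by apply: bopext => h; rewrite /= adjointEl.
by rewrite (has_traceE eb (@has_trace_ketbra _ _ x (adjoint S y))) adjointEl.
Qed.

Lemma trace_comp_ketbra (x y : H2) S : trace (S \ob ketbra x y) = inner y (S x).
Proof.
have -> : S \ob ketbra x y = ketbra (S x) y.
  by apply: bopext => h; rewrite /= bopZ.
by rewrite (has_traceE eb (@has_trace_ketbra _ _ (S x) y)).
Qed.

(** The matrix entries of [Psi (rho_kernel H2 w)] are traces against [ketbra x y], which duality
    moves onto [Phi (ketbra x y)]. The remaining scalar [dbr_kernel f w w] over the squared norm of
    [k w] is the inverse squared norm of [k (f w)]. *)
Lemma preadjoint_rho_kernel Psi w : is_preadjoint Phi Psi ->
  Psi (rho_kernel H2 w) = rho_kernel H2 (f w).
Proof.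
move=> hPsi.
have [_ PsiE] := hPsi (rho_kernel H2 w) (trace_class_ketbra _ _ eb).
apply: bopext => x; apply: inner_ext => y.
rewrite -trace_comp_ketbra PsiE trace_ketbra_comp inner_stinespring.
rewrite !bopZ VE (ampliation_tensor T eb og tg) /=.
rewrite !innerZl !innerZr inner_tensor.
have normV_conj (u : H2) : (`|u|^-1)^* = `|u|^-1.
  by apply: CrealP; rewrite rpredV normr_real.
have normV2 v : `|k v|^-1 * `|k v|^-1 = 1 - (v : R[i]) * (v : R[i])^*.
  by rewrite -invfM -expr2 -innerxx inner_hardy_kernel /szego invrK.
rewrite !normV_conj innerZr.
transitivity (`|k w|^-1 * `|k w|^-1 * inner (c w) (c w) *
  (inner y (k (f w)) * inner (k (f w)) x)); first by ring.
transitivity (`|k (f w)|^-1 * `|k (f w)|^-1 *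
  (inner y (k (f w)) * inner (k (f w)) x)); last by ring.
rewrite !normV2 inner_dbr_kernel /dbr_kernel; congr (_ * _).
by rewrite mulrC divfK// disk_szego_neq0.
Qed.

End Stinespring.

Theorem theorem4p1 (R : realType) (f : disk R -> disk R)
    (hf : holomorphic (fun z => f z : R[i]))
    (H2 : hardySpace R) (Hf : rkhs (dbr_kernel f)) (T : hilbertTensor H2 Hf) :
  exists V : 'B(H2, T),
    let Phi : 'B(H2) -> 'B(H2) := stinespring_map V in
    [/\ (forall w, V (hardy_kernel H2 w)
                   = tensor T (hardy_kernel H2 (f w)) (rkhs_kernel Hf w)) /\
        (forall h, `|V h| = `|h|),
        [/\ linear Phi, completely_positive Phi,
            Phi (id_bop H2) = id_bop H2 & normal Phi],
        total_set [set t : T | exists (S : 'B(H2)) (h : H2),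
                             t = ampliation T S (V h)],
        (forall h, Hinfty h -> forall Mh : 'B(H2),
           is_multiplication h Mh -> is_multiplication (h \o f) (Phi Mh)) &
        (exists Psi, is_preadjoint Phi Psi) /\
        (forall Psi, is_preadjoint Phi Psi ->
           forall w, Psi (rho_kernel H2 w) = rho_kernel H2 (f w))].
Proof.
have [e eb] := hardy_onb H2; have [g og tg] := dbr_orthosystem H2 Hf.
have [V VE] := kernel_isometry_exists T; exists V => Phi; split.
- by split=> [//|h]; rewrite !normE_nsq (nsq_kernel_isometry VE).
- split.
  + exact: stinespring_linear eb og tg.
  + exact: stinespring_completely_positive eb og tg.
  + exact: stinespring_unital eb og tg VE.
  + exact: stinespring_normal eb og tg VE.
- exact: stinespring_minimal eb og tg VE.
- by move=> h _ M hM; exact: (stinespring_multiplication eb og tg VE hM).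
- split; first exact: stinespring_preadjoint eb og tg VE.
  by move=> Psi hPsi w; exact: (preadjoint_rho_kernel eb og tg VE w hPsi).
Qed.
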